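(* Let $(\Omega,\Sigma,\mu)$ be a complete $\sigma$-finite measure space and let $X$ be a Banach function lattice over $(\Omega,\Sigma,\mu)$. (i) If $X$ has the Radon-Nikodým property, then $X$ is order continuous. (ii) Assume that $X$ has the Fatou property and that $(X')_a=(X')_b$. If $X$ is order continuous, then $X$ has the Radon-Nikodým property.
   Context: All spaces are real. $L^0(\Omega)$ is the set of a.e.-equivalence classes of $\mu$-measurable functions $f:\Omega\to\mathbb{R}$. A Banach function lattice over $(\Omega,\Sigma,\mu)$ is a Banach space $(X,\|\cdot\|)$ that is a linear subspace of $L^0(\Omega)$ such that $f\in L^0(\Omega)$, $g\in X$, $|f|\le|g|$ a.e. imply $f\in X$ and $\|f\|\le\|g\|$. As usual, $X$ has full support in $\Omega$ (there is no set $E$ with $\mu(E)>0$ on which every element of $X$ vanishes a.e.). Fatou property: whenever $(f_n)\subset X$, $\sup_n\|f_n\|<\infty$ and $0\le f_n\uparrow f\in L^0(\Omega)$ a.e., then $f\in X$ and $\|f_n\|\uparrow\|f\|$. An element $f\in X$ is order continuous if for every $(f_n)\subset L^0(\Omega)$ with $0\le f_n\le|f|$ and $f_n\downarrow0$ a.e. one has $\|f_n\|\downarrow0$. $X_a$ is the set of all order continuous elements of $X$; $X$ is order continuous if $X=X_a$. A simple function is a finitely valued measurable function whose support has finite measure; $X_b$ is the norm closure in $X$ of the simple functions belonging to $X$. The Köthe dual $X'$ is the set of $x\in L^0(\Omega)$ with $\|x\|_{X'}=\sup\{\int_\Omega|xy|\,d\mu:\ y\in X,\ \|y\|\le1\}<\infty$;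 with this norm it is a Banach function lattice. $(X')_a$ is the set of all order continuous elements of $X'$, i.e. of those $f\in X'$ such that for every $(f_n)\subset L^0(\Omega)$ with $0\le f_n\le|f|$ and $f_n\downarrow0$ a.e. one has $\|f_n\|_{X'}\downarrow0$; $(X')_b$ is the closure in $X'$, with respect to $\|\cdot\|_{X'}$, of the simple functions belonging to $X'$. The Radon-Nikodým property is the classical one for Banach spaces; equivalently, every nonempty closed bounded convex subset of the space has slices of arbitrarily small diameter. *)

(* Defs.v *)
From HB Require Import structures.
From mathcomp Require Import all_boot all_order all_algebra.
From mathcomp Require Import all_classical all_reals all_analysis.
From mathcomp Require Import measurable_realfun.

Set Implicit Arguments.
Unset Strict Implicit.
Unset Printing Implicit Defensive.

Import Order.TTheory GRing.Theory Num.Theory.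
Import numFieldNormedType.Exports.

Local Open Scope classical_set_scope.
Local Open Scope ring_scope.

(* L^0(mu): the library's quotient of the real measurable functions by a.e.
   equality. An element is used as a function through a representative, so
   pointwise statements about it are only meaningful almost everywhere. *)
Definition L0 d (T : measurableType d) (R : realType)
    (mu : {measure set T -> \bar R}) : Type :=
  {mfun_ mu, T >-> R}.

Section L0_lmodule.
Context d (T : measurableType d) (R : realType).
Variable mu : {measure set T -> \bar R}.
Local Open Scope quotient_scope.
Local Notation L := (L0 mu).

HB.instance Definition _ := EqQuotient.on L.
HB.instance Definition _ := Choice.on L.

Definition L0_fun (f : L) : T -> R := repr f.
Coercion L0_fun : L0 >-> Funclass.

Definition L0_class (f : {mfun T >-> R}) : L := \pi_L f.

Lemma L0_classE (f : {mfun T >-> R}) : \forall t \ae mu, L0_class f t = f t.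
Proof.
have /eqP := reprK (\pi_L f).
by rewrite eqmodE => /asboolP; apply: filterS => t; exact.
Qed.

Lemma L0_eqP (f g : L) : (\forall t \ae mu, f t = g t) <-> f = g.
Proof.
split=> [fg|->]; last exact/nearW.
rewrite -(reprK f) -(reprK g); apply/eqP; rewrite eqmodE; apply/asboolP.
by apply: filterS fg => t + _.
Qed.

Let repr' (f : L) : {mfun T >-> R} := repr f.
Definition L0_zero : L := L0_class 0.
Definition L0_opp (f : L) : L := L0_class (- repr' f).
Definition L0_add (f g : L) : L := L0_class (repr' f + repr' g).
Definition L0_scale (a : R) (f : L) : L := L0_class (a *: repr' f).

Lemma L0_zeroE : \forall t \ae mu, L0_zero t = 0.
Proof. exact: L0_classE. Qed.

Lemma L0_oppE (f : L) : \forall t \ae mu, L0_opp f t = - f t.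
Proof. exact: L0_classE. Qed.

Lemma L0_addE (f g : L) : \forall t \ae mu, L0_add f g t = f t + g t.
Proof. exact: L0_classE. Qed.

Lemma L0_scaleE (a : R) (f : L) : \forall t \ae mu, L0_scale a f t = a * f t.
Proof. exact: L0_classE. Qed.

Let addA : associative L0_add.
Proof.
move=> f g h; apply/L0_eqP; near=> t.
rewrite (near (L0_addE f (L0_add g h)) t)// (near (L0_addE g h) t)//.
rewrite (near (L0_addE (L0_add f g) h) t)// (near (L0_addE f g) t)//.
exact: addrA.
Unshelve. all: by end_near. Qed.

Let addC : commutative L0_add.
Proof.
move=> f g; apply/L0_eqP; near=> t.
rewrite (near (L0_addE f g) t)// (near (L0_addE g f) t)//.
exact: addrC.
Unshelve. all: by end_near. Qed.

Let add0 : left_id L0_zero L0_add.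
Proof.
move=> f; apply/L0_eqP; near=> t.
rewrite (near (L0_addE L0_zero f) t)// (near L0_zeroE t)//.
exact: add0r.
Unshelve. all: by end_near. Qed.

Let addN : left_inverse L0_zero L0_opp L0_add.
Proof.
move=> f; apply/L0_eqP; near=> t.
rewrite (near (L0_addE (L0_opp f) f) t)// (near (L0_oppE f) t)//.
rewrite (near L0_zeroE t)//; exact: addNr.
Unshelve. all: by end_near. Qed.

HB.instance Definition _ := GRing.isZmodule.Build L addA addC add0 addN.

Let scaleA a b (f : L) : L0_scale a (L0_scale b f) = L0_scale (a * b) f.
Proof.
apply/L0_eqP; near=> t.
rewrite (near (L0_scaleE a (L0_scale b f)) t)// (near (L0_scaleE b f) t)//.
rewrite (near (L0_scaleE (a * b) f) t)//; exact: mulrA.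
Unshelve. all: by end_near. Qed.

Let scale1 : left_id 1 L0_scale.
Proof.
move=> f; apply/L0_eqP; near=> t.
rewrite (near (L0_scaleE 1 f) t)//; exact: mul1r.
Unshelve. all: by end_near. Qed.

Let scaleDr : right_distributive L0_scale +%R.
Proof.
move=> a f g; apply/L0_eqP; near=> t.
rewrite (near (L0_scaleE a (L0_add f g)) t)// (near (L0_addE f g) t)//.
rewrite (near (L0_addE (L0_scale a f) (L0_scale a g)) t)//.
rewrite (near (L0_scaleE a f) t)// (near (L0_scaleE a g) t)//.
exact: mulrDr.
Unshelve. all: by end_near. Qed.

Let scaleDl (f : L) : {morph L0_scale^~ f : a b / a + b}.
Proof.
move=> a b; apply/L0_eqP; near=> t.
rewrite (near (L0_scaleE (a + b) f) t)//.
rewrite (near (L0_addE (L0_scale a f) (L0_scale b f)) t)//.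
rewrite (near (L0_scaleE a f) t)// (near (L0_scaleE b f) t)//.
exact: mulrDl.
Unshelve. all: by end_near. Qed.

HB.instance Definition _ :=
  GRing.Zmodule_isLmodule.Build R L scaleA scale1 scaleDr scaleDl.

End L0_lmodule.

Section extended_norms.
Context d (T : measurableType d) (R : realType).
Variable mu : {measure set T -> \bar R}.

Definition ae_decreases_to0 (f : nat -> L0 mu) : Prop :=
  \forall t \ae mu, nonincreasing_seq (fun n => f n t) /\
    f n t @[n --> \oo] --> (0 : R).

Definition ae_increases_to (f : nat -> L0 mu) (g : L0 mu) : Prop :=
  \forall t \ae mu, nondecreasing_seq (fun n => f n t) /\
    f n t @[n --> \oo] --> (g t : R).

(* A lattice E in L^0 enters the next definitions through its norm, extended
   to L^0 by +oo outside E; thus f belongs to E iff nu f < +oo. *)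
Variable nu : L0 mu -> \bar R.

Definition order_continuous_part : set (L0 mu) :=
  [set f | (nu f < +oo)%E /\
    forall g : nat -> L0 mu,
      (forall n, \forall t \ae mu, 0 <= g n t <= `|f t|) ->
      ae_decreases_to0 g ->
      nonincreasing_seq (nu \o g) /\ nu (g n) @[n --> \oo] --> 0%E].

Definition is_simple (f : L0 mu) : Prop :=
  exists s : {mfun T >-> R}, [/\ finite_set (range s),
    (mu [set t | s t != 0%R] < +oo)%E & \forall t \ae mu, f t = s t].

Definition simple_closure : set (L0 mu) :=
  [set f | (nu f < +oo)%E /\
    forall e : R, 0 < e ->
      exists g, [/\ is_simple g, (nu g < +oo)%E & (nu (f - g)%R < e%:E)%E]].

End extended_norms.

(* The inclusion of X into L^0 is recorded as an injective linear map, so that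
   X itself is an object of the library's class of Banach spaces. *)
Record banachFunctionLattice d (T : measurableType d) (R : realType)
    (mu : {measure set T -> \bar R}) := BanachFunctionLattice {
  bfl_space :> completeNormedModType R ;
  bfl_val : {linear bfl_space -> L0 mu} ;
  bfl_val_inj : injective bfl_val ;
  bfl_ideal : forall (f : L0 mu) (x : bfl_space),
    (\forall t \ae mu, `|f t| <= `|(bfl_val x : L0 mu) t|) ->
    exists2 y : bfl_space, bfl_val y = f & `|y| <= `|x| ;
  bfl_full_support : forall E : set T, measurable E ->
    (forall x : bfl_space, \forall t \ae mu, E t -> (bfl_val x : L0 mu) t = 0) ->
    mu E = 0%E
}.

Section lattice_properties.
Context d (T : measurableType d) (R : realType).
Variable mu : {measure set T -> \bar R}.
Variable X : banachFunctionLattice mu.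

(* The infimum runs over at most one element, and is +oo if there is none. *)
Definition bfl_norm (f : L0 mu) : \bar R :=
  ereal_inf [set `|x|%:E | x in [set x : X | bfl_val X x = f]].

Definition order_continuous : Prop :=
  order_continuous_part bfl_norm = range (bfl_val X).

Definition fatou_property : Prop :=
  forall (u : nat -> X) (f : L0 mu),
    has_ubound (range (fun n => `|u n|)) ->
    (forall n, \forall t \ae mu, 0 <= (bfl_val X (u n) : L0 mu) t) ->
    ae_increases_to (fun n => bfl_val X (u n)) f ->
    exists x : X, [/\ bfl_val X x = f,
      nondecreasing_seq (fun n => `|u n|) &
      `|u n| @[n --> \oo] --> `|x|].

(* Extended-valued; the Koethe dual X' is the set where it is finite. *)
Definition kothe_norm (f : L0 mu) : \bar R :=
  ereal_sup [set (\int[mu]_t `|f t * (bfl_val X y : L0 mu) t|%:E)%E |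
             y in [set y : X | `|y| <= 1]].

End lattice_properties.

(* The Radon-Nikodym property in its geometric form, by slices: every nonempty
   closed bounded convex set has slices of arbitrarily small diameter. The
   functional phi = 0 is not excluded; it matters only for V = 0, since its
   slice is C itself, and if C has small diameter then so does every slice. *)
Section radon_nikodym.
Context (R : realType) (V : completeNormedModType R).

Definition slice (C : set V) (phi : {scalar V}) (delta : R) : set V :=
  [set x | C x /\ sup (phi @` C) - delta < phi x].

Definition radon_nikodym_property : Prop :=
  forall C : set V, C !=set0 -> closed C -> bounded_set C -> convex_set C ->
  forall e : R, 0 < e ->
  exists (phi : {scalar V}) (delta : R),
    [/\ continuous (phi : V -> R), 0 < delta &
        forall x y, slice C phi delta x -> slice C phi delta y ->
          `|x - y| <= e].

End radon_nikodym.

(* Main.v *)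
Require Import Defs.
From HB Require Import structures.
From mathcomp Require Import all_boot all_order all_algebra.
From mathcomp Require Import all_classical all_reals all_analysis.
From mathcomp Require Import measurable_realfun.
From mathcomp Require Import ring lra.
Import Order.TTheory GRing.Theory Num.Theory.
Import numFieldNormedType.Exports.
Local Open Scope classical_set_scope.
Local Open Scope ring_scope.

Set Implicit Arguments.
Unset Strict Implicit.
Unset Printing Implicit Defensive.

(* (i) If some f_n decreasing to 0 below |f| is not norm-null, then it is not
   norm-Cauchy, and blocks f_(n_k) - f_(n_(k+1)) of norm bounded below span a
   copy of the unit ball of c_00 bounded by f_0. Every slice of its closure
   contains points z + u_k and z - u_k, so its diameter does not tend to 0.

   (ii) The minimiser a of y |-> \int h / (1 + y) over the positive part of the
   unit ball, with h > 0 integrable, yields by first-order optimality a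
   strictly positive element w = h / (1 + a)^2 of the Koethe dual. On the sets
   w >= e the hypothesis on the dual makes bounded sets of X uniformly
   integrable, and so bounded sets are uniformly convex for the weighted
   L^1-norm q with weight w^2. By the Fatou property norm-bounded sets are
   q-complete and balls are q-closed; by order continuity the q-closure of a
   countable set is covered by countably many small balls. A bounded convex
   set without small slices gives rise to a bounded convex set K, the q-closure
   of a countable subset, without norm-small slices by q-continuous functionals.
   There, a slice of K and a small ball B being given, some smaller slice is
   q-small and misses B. Nested slices then shrink to a point of K missed by
   all the balls, a contradiction. *)

(** * Separation by seminorm-dominated functionals *)

(** L^1 of the unit interval shows the obstacle in (ii): it is order continuous with the Fatou
    property, yet lacks the Radon-Nikodym property. Its Koethe dual is L^oo, where simple functions
    are dense but only 0 is order continuous; its unit ball is not uniformly integrable.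

    No convexity estimate is available for the norm of [X], while slices that are small for [q] may
    be large in norm. Hence the two roles: [q] makes nested slices shrink, and norm balls are only
    removed one at a time, as in Baire's theorem. Functionals have to be [q]-continuous so that the
    limit point stays in every slice.

    The integral behind the dual weight is small when [y] is large: to first order its minimiser is
    as large as the unit ball allows, which is why the ball has bounded integrals against [w].
    Strict convexity of [1 / (1 + s)] makes minimising sequences converge almost everywhere, in
    place of a compactness argument. The weight is squared because the hypothesis on the dual acts
    only where [w >= e]; the spare factor [w] makes the remaining set harmless. *)

Section sublinear.
Context (R : realType) (V : lmodType R).
Implicit Types (p q : V -> R) (x y v : V).

Definition sublinear p :=
  (forall x y, p (x + y) <= p x + p y) /\
  (forall t x, 0 < t -> p (t *: x) <= t * p x).

Definition seminorm q :=
  (forall x y, q (x + y) <= q x + q y) /\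
  (forall t x, q (t *: x) = `|t| * q x).

Definition convexly_closed (Q : set V) := forall x y (t : R),
  0 <= t -> t <= 1 -> Q x -> Q y -> Q (t *: x + (1 - t) *: y).

Lemma scalar_comb (phi : {scalar V}) a b x y :
  phi (a *: x + b *: y) = a * phi x + b * phi y.
Proof. by rewrite scalarP linearZ_LR. Qed.

Lemma sublinearZ p t x : sublinear p -> 0 < t -> p (t *: x) = t * p x.
Proof.
move=> [_ pZ] t0; apply/eqP; rewrite eq_le pZ//=.
have := pZ t^-1 (t *: x); rewrite invr_gt0 => /(_ t0).
by rewrite scalerK ?gt_eqF// mulrC ler_pdivlMr// mulrC.
Qed.

Lemma sublinear0 p : sublinear p -> p 0 = 0.
Proof.
move=> ps; have := sublinearZ 0 ps (ltr0Sn R 1); rewrite scaler0 => h.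
by lra.
Qed.

Lemma sublinear_geN p x : sublinear p -> - p (- x) <= p x.
Proof.
by move=> ps; have := ps.1 x (- x); rewrite subrr sublinear0// -lerBlDr sub0r.
Qed.

(** The same criterion serves chains in Zorn's lemma, the perturbation that proves additivity, and
    the functional behind [seminorm_separation]. *)
Lemma inf_sublinear (S : V -> set R) :
  (forall x, S x !=set0) -> (forall x, has_lbound (S x)) ->
  (forall x y a b, S x a -> S y b -> exists2 c, S (x + y) c & c <= a + b) ->
  (forall t x a, 0 < t -> S x a -> exists2 c, S (t *: x) c & c <= t * a) ->
  sublinear (fun x => inf (S x)).
Proof.
move=> S0 Slb SD SZ; split=> [x y|t x t0].
  rewrite -lerBlDr; apply: lb_le_inf => // a Sa.
  rewrite lerBlDr -lerBlDl; apply: lb_le_inf => // b Sb.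
  rewrite lerBlDl; have [c Sc cab] := SD _ _ _ _ Sa Sb.
  by apply: le_trans cab; exact: ge_inf.
rewrite mulrC -ler_pdivrMr//; apply: lb_le_inf => // a Sa.
rewrite ler_pdivrMr// mulrC; have [c Sc cab] := SZ _ _ _ t0 Sa.
by apply: le_trans cab; exact: ge_inf.
Qed.

Lemma sublinear_minimal p : sublinear p ->
  exists m, [/\ sublinear m, forall x, m x <= p x &
    forall n, sublinear n -> (forall x, n x <= m x) -> n = m].
Proof.
move=> ps.
pose U := {n : V -> R | sublinear n /\ forall x, n x <= p x}.
(* The order is reversed, so that a maximal element in Zorn's lemma is a minimal functional. *)
pose below (s t : U) := `[< forall x, sval t x <= sval s x >].
have [| | | |[m [ms mp]] mmin] := @Zorn U below.
- by move=> s; apply/asboolP.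
- move=> r s t /asboolP rs /asboolP st; apply/asboolP => x.
  exact: le_trans (st x) (rs x).
- move=> [s sP] [t tP] /asboolP/= st /asboolP/= ts.
  have e : s = t by apply/funext => x; apply/eqP; rewrite eq_le st ts.
  by subst t; congr exist; exact: Prop_irrelevance.
- move=> A Atot.
  have [->|/set0P[a0 Aa0]] := eqVneq A set0.
    by exists (exist _ p (conj ps (fun x => lexx (p x)))).
  pose S x := [set sval s x | s in A].
  have Slb x : lbound (S x) (- p (- x)).
    move=> _ [[s [ss sp]] _ <-] /=.
    by apply: le_trans (sublinear_geN x ss); rewrite lerN2.
  have ims : sublinear (fun x => inf (S x)).
    apply: inf_sublinear.
    - by move=> x; exists (sval a0 x); exists a0.
    - by move=> x; exists (- p (- x)).
    - move=> x y _ _ [s As <-] [t At <-].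
      have [/asboolP st|/asboolP ts] := Atot _ _ As At.
        exists (sval t (x + y)); first by exists t.
        by apply: le_trans ((svalP t).1.1 _ _) _; rewrite lerD2r st.
      exists (sval s (x + y)); first by exists s.
      by apply: le_trans ((svalP s).1.1 _ _) _; rewrite lerD2l ts.
    - move=> t x _ t0 [s As <-]; exists (sval s (t *: x)); first by exists s.
      exact: (svalP s).1.2.
  have imp x : inf (S x) <= p x.
    apply: le_trans ((svalP a0).2 x); apply: ge_inf; last by exists a0.
    by exists (- p (- x)).
  exists (exist _ (fun x => inf (S x)) (conj ims imp)) => s As.
  apply/asboolP => x /=; apply: ge_inf; last by exists s.
  by exists (- p (- x)).
exists m; split=> // n ns nm.
have np x : n x <= p x := le_trans (nm x) (mp x).
by have /(congr1 sval) := mmin (exist _ n (conj ns np)) (introT (asboolP _) nm).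
Qed.

(* A minimal sublinear functional [m] is additive: otherwise
   [x |-> inf_(t >= 0) (m (x + t y) - t m y)] would lie below it. *)
Theorem sublinear_linear_minorant p : sublinear p ->
  exists phi : {scalar V}, forall x, phi x <= p x.
Proof.
move=> /sublinear_minimal[m [ms mp mmin]].
have mD y x : m x + m y <= m (x + y).
  pose S x := [set m (x + t *: y) - t * m y | t in [set t : R | 0 <= t]].
  have Slb x' : lbound (S x') (- m (- x')).
    move=> _ [t /= t0 <-]; rewrite lerBrDr.
    have [->|tn0] := eqVneq t 0.
      by rewrite mul0r addr0 scale0r addr0 sublinear_geN.
    have tp : 0 < t by rewrite lt_neqAle eq_sym tn0.
    rewrite -(sublinearZ _ ms tp) addrC lerBlDr.
    by apply: le_trans (ms.1 _ _); rewrite (addrC x') addrK.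
  have Ss : sublinear (fun x => inf (S x)).
    apply: inf_sublinear.
    - by move=> x'; exists (m (x' + 0 *: y) - 0 * m y); exists 0 => /=.
    - by move=> x'; exists (- m (- x')).
    - move=> x1 x2 _ _ [t /= t0 <-] [s /= s0 <-].
      exists (m (x1 + x2 + (t + s) *: y) - (t + s) * m y).
        by exists (t + s) => //=; exact: addr_ge0.
      rewrite scalerDl addrACA mulrDl opprD (addrACA (m (x1 + _))) lerD2r.
      exact: ms.1.
    - move=> s x' _ s0 [t /= t0 <-].
      exists (m (s *: x' + (s * t) *: y) - s * t * m y).
        by exists (s * t) => //=; rewrite mulr_ge0// ltW.
      by rewrite -scalerA -scalerDr mulrBr mulrA lerD2r; exact: ms.2.
  have Sm x' : inf (S x') <= m x'.
    apply: ge_inf; first by exists (- m (- x')).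
    by exists 0 => //=; rewrite scale0r addr0 mul0r subr0.
  have /(congr1 (@^~ x)) <- := mmin _ Ss Sm.
  rewrite -lerBrDr; apply: ge_inf; first by exists (- m (- x)).
  by exists 1 => //=; rewrite scale1r mul1r.
have madd x y : m (x + y) = m x + m y by apply/le_anti; rewrite ms.1 mD.
have mN x : m (- x) = - m x.
  by apply/eqP; rewrite -addr_eq0 -madd addNr sublinear0.
have mlin : scalar m.
  move=> a x y; rewrite madd; congr (_ + _).
  have [->|an0] := eqVneq a 0; first by rewrite scale0r mul0r sublinear0.
  have [a0|a0] := ltP 0 a; first exact: sublinearZ.
  have na0 : 0 < - a by rewrite oppr_gt0 lt_neqAle an0.
  by apply: oppr_inj; rewrite -mN -scaleNr sublinearZ// mulNr.
pose L := GRing.isLinear.Build R V R *%R m mlin.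
by exists (HB.pack_for {scalar V} m L).
Qed.

Section seminorm.
Variable q : V -> R.
Hypothesis sq : seminorm q.

Lemma seminormN x : q (- x) = q x.
Proof. by rewrite -scaleN1r sq.2 normrN1 mul1r. Qed.

Lemma seminorm0 : q 0 = 0.
Proof. by rewrite -(scale0r 0) sq.2 normr0 mul0r. Qed.

Lemma seminorm_ge0 x : 0 <= q x.
Proof.
have := sq.1 x (- x); rewrite subrr seminorm0 seminormN => h; lra.
Qed.

Lemma seminormB x y : q (x - y) = q (y - x).
Proof. by rewrite -seminormN opprB. Qed.

Lemma seminorm_triangle x y z : q (x - z) <= q (x - y) + q (y - z).
Proof. by have := sq.1 (x - y) (y - z); rewrite addrA subrK. Qed.

(** For nonempty [Q], the infimum of [q (v + t *: (x0 - y)) - t * d] over [t >= 0] and [y] in [Q] is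
    sublinear in [v] because [Q] is convex. It lies below [q] (take [t = 0]) and is at most [- d] at
    [y - x0] (take [t = 1]); a linear minorant inherits both bounds. *)
Lemma seminorm_separation (Q : set V) (x0 : V) (d : R) :
  convexly_closed Q -> (forall y, Q y -> d <= q (x0 - y)) ->
  exists phi : {scalar V},
    (forall v, `|phi v| <= q v) /\ forall y, Q y -> phi y + d <= phi x0.
Proof.
move=> Qconv Qd.
have phiN (phi : {scalar V}) :
    (forall v, phi v <= q v) -> forall v, `|phi v| <= q v.
  move=> h v; rewrite ler_norml h andbT lerNl -raddfN -[leRHS]seminormN; exact: h.
have [->|/set0P[y0 Qy0]] := eqVneq Q set0.
  have [|phi phiq] := @sublinear_linear_minorant q.
    by split=> [|t x t0]; [exact: sq.1|rewrite sq.2 gtr0_norm].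
  by exists phi; split => //; exact: phiN.
pose S v := [set r | exists t y, [/\ 0 <= t, Q y & r = q (v + t *: (x0 - y)) - t * d]].
have Slb v : lbound (S v) (- q v).
  move=> _ [t [y [t0 Qy ->]]].
  have := sq.1 (v + t *: (x0 - y)) (- v).
  rewrite addrAC subrr add0r sq.2 ger0_norm// seminormN.
  have := ler_wpM2l t0 (Qd _ Qy); lra.
have Ss : sublinear (fun x => inf (S x)).
  apply: inf_sublinear.
  - by move=> v; eexists; exists 0, y0.
  - by move=> v; exists (- q v).
  - move=> v1 v2 _ _ [t [y [t0 Qy ->]]] [s [z [s0 Qz ->]]].
    have [ts|ts] := eqVneq (t + s) 0.
      have -> : t = 0 by lra.
      have -> : s = 0 by lra.
      exists (q (v1 + v2)).
        by exists 0, y0; rewrite scale0r addr0 mul0r subr0.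
      by rewrite !scale0r !addr0 !mul0r !subr0; exact: sq.1.
    have tsp : 0 < t + s by rewrite lt_neqAle eq_sym ts addr_ge0.
    exists (q (v1 + v2 + (t + s) *: (x0 - (t / (t + s) *: y + (1 - t / (t + s)) *: z)))
            - (t + s) * d).
      exists (t + s), (t / (t + s) *: y + (1 - t / (t + s)) *: z); split => //.
      + exact: addr_ge0.
      + apply: Qconv => //; first by rewrite divr_ge0// ltW.
        by rewrite ler_pdivrMr// mul1r lerDl.
    have -> : v1 + v2 + (t + s) *: (x0 - (t / (t + s) *: y + (1 - t / (t + s)) *: z)) =
       (v1 + t *: (x0 - y)) + (v2 + s *: (x0 - z)).
      rewrite addrACA; congr (_ + _).
      have e : (t + s) * (t / (t + s)) = t by rewrite mulrC divfK.
      rewrite !scalerBr scalerDr !scalerA mulrBr mulr1 e (addrC t s) addrK.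
      by rewrite (addrC s t) scalerDl opprD addrACA.
    have := sq.1 (v1 + t *: (x0 - y)) (v2 + s *: (x0 - z)); lra.
  - move=> s v _ s0 [t [y [t0 Qy ->]]].
    exists (q (s *: v + (s * t) *: (x0 - y)) - s * t * d).
      by exists (s * t), y; split => //; rewrite mulr_ge0// ltW.
    by rewrite -scalerA -scalerDr sq.2 gtr0_norm// mulrBr mulrA.
have [phi phip] := sublinear_linear_minorant Ss.
exists phi; split.
  apply: phiN => v; apply: le_trans (phip v) _.
  apply: ge_inf; first by exists (- q v).
  by exists 0, y0; rewrite scale0r addr0 mul0r subr0.
move=> y Qy.
suff : phi (y - x0) <= - d by rewrite raddfB; lra.
apply: le_trans (phip _) _; apply: ge_inf; first by eexists; exact: Slb.
exists 1, y; split => //.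
by rewrite scale1r -(opprB y x0) subrr seminorm0 mul1r sub0r.
Qed.

End seminorm.
End sublinear.

(** * Nested slices *)

Section caps.
Context (R : realType) (V : normedModType R) (q : V -> R).
Hypothesis sq : seminorm q.

Definition qclosure (A : set V) : set V :=
  [set x | forall e, 0 < e -> exists2 y, A y & q (x - y) < e].

Definition balls_qclosed := forall (x : V) (M : R),
  qclosure [set y | `|y| <= M] x -> `|x| <= M.

(** Only fast sequences are considered: [8^-1 ^+ n] stays summable after multiplication by [4 ^+ n],
    which is how [fast_ae] obtains almost everywhere convergence. *)
Definition bounded_qcomplete := forall (u : nat -> V) (M : R),
  (forall n, `|u n| <= M) -> (forall n, q (u n.+1 - u n) <= 8^-1 ^+ n) ->
  exists x, forall e, 0 < e -> exists n, forall m, (n <= m)%N -> q (x - u m) < e.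

(** A weighted L^1-norm need not even be strictly convex, so the convexity is carried by an
    auxiliary [q]-Lipschitz function, which may depend on the ball and on the scale [r]. *)
Definition bounded_quniformly_convex := forall M r : R, 0 < r ->
  exists (Phi : V -> R) (L gam : R), [/\ 0 < gam,
    forall x y t, 0 <= t -> t <= 1 ->
      Phi (t *: x + (1 - t) *: y) <= t * Phi x + (1 - t) * Phi y,
    forall x y, Phi x - Phi y <= L * q (x - y) &
    forall x y, `|x| <= M -> `|y| <= M -> r < q (x - y) ->
      Phi (2^-1 *: x + (1 - 2^-1) *: y) <=
        2^-1 * Phi x + (1 - 2^-1) * Phi y - gam].

Hypotheses (qball : balls_qclosed) (qcomp : bounded_qcomplete)
  (quc : bounded_quniformly_convex).
Variable c0 : R.
Hypothesis qle : forall x, q x <= c0 * `|x|.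

Variables (K : set V) (M rho : R).
Hypotheses (K0 : K !=set0) (Kconv : convexly_closed K)
  (KM : forall x, K x -> `|x| <= M) (Kq : qclosure K `<=` K) (rho0 : 0 < rho).

Hypothesis Kbad : forall (phi : {scalar V}) (L c : R),
  (forall v, `|phi v| <= L * q v) -> (exists2 x, K x & c < phi x) ->
  exists x y, [/\ K x, K y, c < phi x, c < phi y & 4 * rho < `|x - y|].

Let phi_bounded (phi : {scalar V}) x y : (forall v, `|phi v| <= q v) ->
  K x -> K y -> phi x - phi y <= `|c0| * (M + M).
Proof.
move=> phiq Kx Ky; rewrite -raddfB; apply: le_trans (ler_norm _) _.
apply: le_trans (phiq _) _; apply: le_trans (qle _) _.
apply: le_trans (ler_norm _) _; rewrite normrM normr_id ler_wpM2l//.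
by apply: le_trans (ler_normB _ _) _; apply: lerD; exact: KM.
Qed.

(** With [s] the supremum of [phi] on [K], one convex function [G y = |y - e| + kap * (phi y - s)]
    handles both sets to be avoided: each lies in [G <= rho]. High up in [phi] the set [K] has a
    point with [G > rho], and as balls are [q]-closed this point is at positive [q]-distance from
    the part of [K] where [G <= rho]. *)
Lemma cap_avoiding_ball (phi : {scalar V}) (c : R) (e : V) :
  (forall v, `|phi v| <= q v) -> (exists2 x, K x & c < phi x) ->
  exists (psi : {scalar V}) (d : R) x1, [/\ 0 < d, forall v, `|psi v| <= q v, K x1 &
    forall y, K y -> phi y <= c \/ `|y - e| <= rho -> psi y + d <= psi x1].
Proof.
move=> phiq [x0 Kx0 cx0].
have phis : has_sup (phi @` K).
  split; first by exists (phi x0); exists x0.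
  exists (phi x0 + `|c0| * (M + M)) => _ [y Ky <-].
  by rewrite -lerBlDl; exact: phi_bounded.
set s := sup (phi @` K).
have phi_s y : K y -> phi y <= s.
  by move=> Ky; apply: sup_upper_bound => //; exists y.
have cs : 0 < s - c by rewrite subr_gt0; apply: lt_le_trans (phi_s _ Kx0).
have M0 : 0 <= M := le_trans (normr_ge0 _) (KM Kx0).
(* This slope turns [phi y <= c] into [kap * (phi y - s) <= - (M + |e|)], hence [G y <= 0] for such
   [y] in [K]. *)
pose kap := (M + `|e|) / (s - c).
have kap0 : 0 <= kap by apply: divr_ge0; [exact: addr_ge0|exact: ltW].
pose G y := `|y - e| + kap * (phi y - s).
have [x1 Kx1 Gx1] : exists2 x1, K x1 & rho < G x1.
  (* Above [c'] the penalty [kap * (s - phi z)] is at most [rho], so [G z <= rho] would put [z]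
     within [2 * rho] of [e]; two points more than [4 * rho] apart cannot both be there. *)
  pose c' := s - rho / (kap + 1).
  have k1 : 0 < kap + 1 by rewrite ltr_wpDl.
  have [x [y [Kx Ky cx cy rxy]]] : exists x y,
      [/\ K x, K y, c' < phi x, c' < phi y & 4 * rho < `|x - y|].
    apply: (@Kbad phi 1); first by move=> v; rewrite mul1r.
    have [|_ [x Kx <-] sx] := @sup_adherent _ (phi @` K) (rho / (kap + 1)) _ phis.
      by rewrite divr_gt0.
    by exists x.
  have far z : K z -> c' < phi z -> G z <= rho -> `|z - e| <= 2 * rho.
    move=> Kz cz; rewrite /G => Gz.
    have : kap * (s - phi z) <= (kap + 1) * (rho / (kap + 1)).
      have sz : s - phi z <= rho / (kap + 1) by rewrite /c' in cz; lra.
      have sz0 : 0 <= s - phi z by rewrite subr_ge0 phi_s.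
      by apply: ler_pM => //; rewrite lerDl.
    rewrite [leRHS]mulrC divfK ?gt_eqF// => h; lra.
  have [Gx|?] := leP (G x) rho; last by exists x.
  have [Gy|?] := leP (G y) rho; last by exists y.
  have := ler_distD e x y; rewrite (distrC e y).
  by have := far _ Kx cx Gx; have := far _ Ky cy Gy; lra.
pose Z := [set y | K y /\ G y <= rho].
have Zconv : convexly_closed Z.
  move=> x y t t0 t1 [Kx Gx] [Ky Gy]; split; first exact: Kconv.
  have -> : rho = t * rho + (1 - t) * rho by ring.
  apply: le_trans (lerD (ler_wpM2l t0 Gx) (ler_wpM2l _ Gy)); last by lra.
  rewrite /G (scalar_comb phi).
  have -> : t *: x + (1 - t) *: y - e = t *: (x - e) + (1 - t) *: (y - e).
    by rewrite !scalerBr addrACA -opprD -scalerDl [t + _]addrC subrK scale1r.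
  have := ler_normD (t *: (x - e)) ((1 - t) *: (y - e)).
  rewrite !normrZ (ger0_norm t0) (@ger0_norm _ (1 - t)); last by lra.
  lra.
have [d [d0 Zd]] : exists d : R, 0 < d /\ forall y, Z y -> d <= q (x1 - y).
  apply: contrapT => nd.
  have small d : 0 < d -> exists2 y, Z y & q (x1 - y) < d.
    move=> d0; apply: contrapT => h; apply: nd; exists d; split => // y Zy.
    by rewrite leNgt; apply/negP => h'; apply: h; exists y.
  move: Gx1; apply/negP; rewrite -leNgt /G.
  suff : `|x1 - e| <= rho + kap * (s - phi x1) by lra.
  apply/ler_addgt0Pr => eps eps0; apply: qball => eta eta0 /=.
  have k1 : 0 < kap + 1 by rewrite ltr_wpDl.
  have [|y [Ky Gy] qy] := small (Num.min eta (eps / (kap + 1))).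
    by rewrite lt_min eta0 divr_gt0.
  move: qy; rewrite lt_min => /andP[qy1 qy2].
  exists (y - e) => /=; last by rewrite opprB addrA subrK.
  have : kap * (phi x1 - phi y) <= (kap + 1) * (eps / (kap + 1)).
    have h : phi x1 - phi y <= eps / (kap + 1).
      rewrite -raddfB; apply: le_trans (ler_norm _) _.
      by apply: le_trans (phiq _) _; exact: ltW.
    apply: le_trans (ler_wpM2l kap0 h) _; rewrite ler_wpM2r ?lerDl//.
    by rewrite divr_ge0// ltW.
  rewrite [leRHS]mulrC divfK ?gt_eqF// => h.
  by move: Gy; rewrite /G; lra.
have [psi [psiq psiZ]] := seminorm_separation sq Zconv Zd.
exists psi, d, x1; split => // y Ky hy; apply: psiZ; split => //; rewrite /G.
have sy : 0 <= s - phi y by rewrite subr_ge0 phi_s.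
case: hy => [yc|yrho].
  have : (M + `|e|) <= kap * (s - phi y).
    rewrite /kap -mulrA ler_peMr ?addr_ge0// mulrC ler_pdivlMr// mul1r; lra.
  have h1 := KM Ky; have h2 := ler_normB y e => h3.
  have -> : kap * (phi y - s) = - (kap * (s - phi y)) by rewrite -mulrN opprB.
  by have := ltW rho0; lra.
have := mulr_ge0 kap0 sy; lra.
Qed.

(** The convex function [F = Phi + t * phi] is considered near its supremum [S], not near a minimum.
    A slice missing the convex set [F <= S - gam] has small [q]-diameter: the midpoint of two
    [q]-distant points stays in the slice, but there [F] falls to [S - gam] or below. *)
Lemma qsmall_cap (phi : {scalar V}) (c r : R) : 0 < r ->
  (forall v, `|phi v| <= q v) -> (exists2 x, K x & c < phi x) ->
  exists (chi : {scalar V}) (b : R), [/\ forall v, `|chi v| <= q v,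
    exists2 x, K x & b < chi x,
    forall y, K y -> b <= chi y -> c < phi y &
    forall y z, K y -> K z -> b <= chi y -> b <= chi z -> q (y - z) <= r].
Proof.
move=> r0 phiq [x0 Kx0 cx0].
have [Phi [L [gam [gam0 Phiconv PhiL Phir]]]] := quc M r0.
have M0 : 0 <= M := le_trans (normr_ge0 _) (KM Kx0).
have qK x y : K x -> K y -> q (x - y) <= `|c0| * (M + M).
  move=> Kx Ky; apply: le_trans (qle _) _.
  apply: le_trans (ler_norm _) _; rewrite normrM normr_id ler_wpM2l//.
  by apply: le_trans (ler_normB _ _) _; apply: lerD; exact: KM.
pose B := `|L| * (`|c0| * (M + M)).
have PhiB x y : K x -> K y -> Phi x - Phi y <= B.
  move=> Kx Ky; apply: le_trans (PhiL _ _) _.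
  apply: (@le_trans _ _ (`|L| * q (x - y))).
    by rewrite ler_wpM2r ?seminorm_ge0// ler_norm.
  by rewrite ler_wpM2l// qK.
have B0 : 0 <= B by rewrite !mulr_ge0// addr_ge0.
have pc : 0 < phi x0 - c by rewrite subr_gt0.
(* As [Phi] varies by at most [B] on [K], this weight of [phi] forces [phi y > c] wherever
   [F y > S - gam]. *)
pose t := (B + gam) / (phi x0 - c).
have t0 : 0 <= t by apply: divr_ge0; [apply: addr_ge0 => //; exact: ltW|exact: ltW].
pose F y := Phi y + t * phi y.
have Fs : has_sup (F @` K).
  split; first by exists (F x0); exists x0.
  exists (F x0 + (B + t * (`|c0| * (M + M)))) => _ [y Ky <-].
  have h1 := PhiB _ _ Ky Kx0.
  have h2 := ler_wpM2l t0 (phi_bounded phiq Ky Kx0).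
  rewrite /F; lra.
set S := sup (F @` K).
have F_S y : K y -> F y <= S.
  by move=> Ky; apply: sup_upper_bound => //; exists y.
have [|_ [x' Kx' <-] Sx'] := @sup_adherent _ (F @` K) (gam / 2) _ Fs.
  by rewrite divr_gt0.
have Fconv x y a : 0 <= a -> a <= 1 ->
    F (a *: x + (1 - a) *: y) <= a * F x + (1 - a) * F y.
  move=> a0 a1; rewrite /F (scalar_comb phi).
  by have := Phiconv x y a a0 a1; lra.
pose Q := [set y | K y /\ F y <= S - gam].
have Qconv : convexly_closed Q.
  move=> x y a a0 a1 [Kx Fx] [Ky Fy]; split; first exact: Kconv.
  apply: le_trans (Fconv _ _ _ a0 a1) _.
  have -> : S - gam = a * (S - gam) + (1 - a) * (S - gam) by ring.
  by apply: lerD; rewrite ler_wpM2l//; lra.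
pose L' := `|L| + t + 1.
have L'0 : 0 < L' by rewrite ltr_wpDl// addr_ge0.
pose d := gam / 2 / L'.
have d0 : 0 < d by rewrite !divr_gt0.
have Qd y : Q y -> d <= q (x' - y).
  move=> [Ky Fy]; rewrite ler_pdivrMr// mulrC.
  have h1 : Phi x' - Phi y <= `|L| * q (x' - y).
    apply: le_trans (PhiL _ _) _.
    by rewrite ler_wpM2r ?seminorm_ge0// ler_norm.
  have h2 : t * (phi x' - phi y) <= t * q (x' - y).
    by apply: ler_wpM2l => //; rewrite -raddfB; apply: le_trans (ler_norm _) _; exact: phiq.
  have h3 := seminorm_ge0 sq (x' - y).
  move: Fy Sx'; rewrite /F /L' -/S; lra.
have [chi [chiq chiQ]] := seminorm_separation sq Qconv Qd.
have notQ y : K y -> chi x' - d / 2 <= chi y -> S - gam < F y.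
  move=> Ky cy; rewrite ltNge; apply/negP => Fy.
  by have := chiQ y (conj Ky Fy); lra.
exists chi, (chi x' - d / 2); split => //.
- by exists x' => //; lra.
- move=> y Ky /notQ -/(_ Ky) Fy.
  have h1 : F x0 <= S := F_S _ Kx0.
  have h2 := PhiB _ _ Ky Kx0.
  have : t * (phi x0 - c) = B + gam by rewrite divfK// gt_eqF.
  move=> h3; rewrite ltNge; apply/negP => yc.
  have h4 : t * phi y <= t * c by rewrite ler_wpM2l.
  move: Fy h1; rewrite /F; lra.
- move=> y z Ky Kz cy cz; rewrite leNgt; apply/negP => ryz.
  have h := Phir _ _ (KM Ky) (KM Kz) ryz.
  have : S - gam < F (2^-1 *: y + (1 - 2^-1) *: z).
    apply: notQ; first by apply: Kconv => //; lra.
    rewrite (scalar_comb chi); lra.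
  have := F_S _ Ky; have := F_S _ Kz.
  rewrite /F (scalar_comb phi); lra.
Qed.

(* Nested slices of [q]-diameter tending to 0, the [n]-th one missing the
   [n]-th ball, have a common point in [K] that no ball contains. *)
Lemma no_countable_cover (e : nat -> V) :
  ~ (forall x, K x -> exists n, `|x - e n| <= rho).
Proof.
move=> cov.
pose good (s : {scalar V} * R) :=
  (forall v, `|s.1 v| <= q v) /\ exists2 x, K x & s.2 < s.1 x.
pose next n (s s' : {scalar V} * R) := good s -> [/\ good s',
  forall y, K y -> s'.2 <= s'.1 y -> s.2 <= s.1 y /\ rho < `|y - e n| &
  forall y z, K y -> K z -> s'.2 <= s'.1 y -> s'.2 <= s'.1 z ->
    q (y - z) <= 8^-1 ^+ n].
have ex_next n s : exists s', next n s s'.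
  have [gs|] := pselect (good s); last by exists s.
  have [psi [d [x1 [d0 psiq Kx1 psiK]]]] := cap_avoiding_ball (e n) gs.1 gs.2.
  have [||chi [b [chiq chib chipsi chidiam]]] :=
    @qsmall_cap psi (psi x1 - d) (8^-1 ^+ n) _ psiq.
  - by rewrite exprn_gt0.
  - by exists x1 => //; lra.
  exists (chi, b) => _; split => //= y Ky by_.
  have h := chipsi _ Ky by_.
  split; rewrite leNgt || rewrite ltNge; apply/negP => h'.
    by have := psiK _ Ky (or_introl (ltW h')); lra.
  by have := psiK _ Ky (or_intror h'); lra.
have [f fP] := choice (fun ns : nat * ({scalar V} * R) => ex_next ns.1 ns.2).
have [k0 Kk0] := K0.
(* Separation from the empty set only serves to produce some functional dominated by [q]. *)
have [||phi0 [phi0q _]] := @seminorm_separation _ _ q sq set0 0 0 => //.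
pose st := fix st n : {scalar V} * R :=
  if n is m.+1 then f (m, st m) else (phi0, phi0 k0 - 1).
have gst n : good (st n).
  elim: n => [|n IH]; last by have [] := fP (n, st n) IH.
  by split => //=; exists k0 => //; rewrite ltrBlDr ltrDl.
have stS n := fP (n, st n) (gst n).
have [x xP] := choice (fun n => let: ex_intro2 x Kx h := (gst n).2 in
   ex_intro (fun x => K x /\ (st n).2 < (st n).1 x) x (conj Kx h)).
have mono n k y : K y -> (st (n + k)%N).2 <= (st (n + k)%N).1 y -> (st n).2 <= (st n).1 y.
  move=> Ky; elim: k => [|k IH]; first by rewrite addn0.
  by rewrite addnS => h; apply: IH; have [_ /(_ _ Ky h)[]] := stS (n + k)%N.
have xmono n m : (n <= m)%N -> (st n).2 <= (st n).1 (x m).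
  move=> nm; apply: (mono n (m - n)%N); first by case: (xP m).
  by rewrite subnKC// ltW//; case: (xP m).
have Kx n : K (x n) by case: (xP n).
(* The shift reflects that it is the slice of index [n.+1] whose [q]-diameter is at most
   [8^-1 ^+ n]. *)
have [||y yP] := @qcomp (fun n => x n.+1) M.
- by move=> n; exact: KM.
- by move=> n; have [_ _] := stS n; apply => //; exact: (xmono n.+1).
have Ky : K y.
  by apply: Kq => eps /yP[n /(_ n (leqnn n))]; exists (x n.+1).
(* The nesting is stated for the closed slices, with [<=], and so survives the passage to the
   [q]-limit [y]. *)
have yst n : (st n).2 <= (st n).1 y.
  apply/ler_addgt0Pr => eps /yP[m /(_ (maxn m n) (leq_maxl _ _)) h].
  have h1 : (st n).2 <= (st n).1 (x (maxn m n).+1).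
    by apply: xmono; rewrite (leq_trans (leq_maxr m n)).
  have h2 := le_trans (ler_norm _) ((gst n).1 (x (maxn m n).+1 - y)).
  by move: h2; rewrite raddfB (seminormB sq); lra.
have [n] := cov y Ky; rewrite leNgt => /negP; apply.
by have [_ /(_ _ Ky (yst n.+1))[]] := stS n.
Qed.

End caps.

(** * A criterion for the Radon-Nikodym property *)

(** The closure is enumerated by its terms: binary trees whose node labels encode [i], every
    ill-formed tree or leaf denoting [a0]. *)
Lemma countable_closure (I : countType) (T : Type) (F : I -> T -> T -> T)
    (P : set T) (a0 : T) :
  P a0 -> (forall i x y, P x -> P y -> P (F i x y)) ->
  exists a : nat -> T,
    (forall n, P (a n)) /\ forall i n m, exists k, a k = F i (a n) (a m).
Proof.
move=> Pa0 PF.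
pose ev := fix ev (t : GenTree.tree nat) : T :=
  if t is GenTree.Node c [:: t1; t2] then
    if unpickle c is Some i then F i (ev t1) (ev t2) else a0
  else a0.
have Pev : forall t, P (ev t).
  fix Pev 1; case=> [m|c [|t1 [|t2 [|t3 l]]]] //=.
  by case: unpickle => // i; apply: PF; exact: Pev.
pose a n := if unpickle n is Some t then ev t else a0.
have aE t : a (pickle t) = ev t by rewrite /a pickleK.
have aP n : exists t, a n = ev t.
  by rewrite /a; case: unpickle => [t|]; [exists t|exists (GenTree.Leaf 0)].
exists a; split.
  by move=> n; have [t ->] := aP n; exact: Pev.
move=> i n m; have [t1 ->] := aP n; have [t2 ->] := aP m.
by exists (pickle (GenTree.Node (pickle i) [:: t1; t2])); rewrite aE /= pickleK.
Qed.

Lemma half_expr_lt (R : realType) (x : R) :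
  0 < x -> exists k : nat, 2^-1 ^+ k < x.
Proof.
move=> x0; have h : `|2^-1 : R| < 1 by rewrite ger0_norm//; lra.
have /cvgrPdist_lt/(_ x x0)[k _ /(_ k (leqnn k))] := cvg_expr h.
by rewrite sub0r normrN ger0_norm ?exprn_ge0//; exists k.
Qed.

(** Coefficients are avoided: a point belongs if some finite list of points of [S] forces it into
    every convex set containing the list. The list is explicit because [abstract_rnp] builds a
    countable set from such lists. *)
Definition convex_hull (R : realType) (V : lmodType R) (S : set V) : set V :=
  [set x | exists s : seq V, (forall y, y \in s -> S y) /\
     forall Z, convexly_closed Z -> (forall y, y \in s -> Z y) -> Z x].

Lemma convex_hull_closed (R : realType) (V : lmodType R) (S : set V) :
  convexly_closed (convex_hull S).
Proof.
move=> x y t t0 t1 [s [sS sx]] [s' [s'S s'y]]; exists (s ++ s'); split.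
  by move=> z; rewrite mem_cat => /orP[/sS|/s'S].
move=> Z Zc Zs; apply: (Zc) => //.
  by apply: sx Zc _ => z zs; apply: Zs; rewrite mem_cat zs.
by apply: s'y Zc _ => z zs; apply: Zs; rewrite mem_cat zs orbT.
Qed.

Lemma sub_convex_hull (R : realType) (V : lmodType R) (S : set V) :
  S `<=` convex_hull S.
Proof.
move=> x Sx; exists [:: x]; split; first by move=> y; rewrite inE => /eqP ->.
by move=> Z _; apply; rewrite inE.
Qed.

Lemma seminorm_norm (R : realType) (V : normedModType R) :
  seminorm (fun x : V => `|x|).
Proof. by split => [x y|t x]; [exact: ler_normD|exact: normrZ]. Qed.

Lemma dominated_continuous (R : realType) (V : normedModType R)
    (phi : {scalar V}) (L : R) :
  (forall v, `|phi v| <= L * `|v|) -> continuous (phi : V -> R).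
Proof.
move=> phiL x; apply/cvgrPdist_lt => e e0.
have L0 : 0 < `|L| + 1 by rewrite ltr_wpDl.
near=> y; rewrite -raddfB; apply: le_lt_trans (phiL _) _.
apply: (@le_lt_trans _ _ ((`|L| + 1) * `|x - y|)).
  by rewrite ler_wpM2r// (le_trans (ler_norm _))// lerDl.
rewrite mulrC -ltr_pdivlMr//; near: y.
apply: (@cvgr_dist_lt _ _ _ _ _ id) => //.
by rewrite divr_gt0.
Unshelve. all: by end_near. Qed.

Lemma convexly_closed_scalar_le (R : realType) (V : lmodType R)
    (phi : {scalar V}) (c : R) : convexly_closed [set x | phi x <= c].
Proof.
move=> x y t t0 t1 /= xc yc; rewrite (scalar_comb phi).
have -> : c = t * c + (1 - t) * c by ring.
by apply: lerD; apply: ler_wpM2l => //; lra.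
Qed.

Section abstract.
Context (R : realType) (V : completeNormedModType R) (q : V -> R).
Hypothesis sq : seminorm q.
Variable c0 : R.
Hypothesis qle : forall x, q x <= c0 * `|x|.
Hypotheses (qball : balls_qclosed q) (qcomp : bounded_qcomplete q)
  (quc : bounded_quniformly_convex q).
Hypothesis qsep : forall a : nat -> V, exists e : nat -> V,
  forall x, qclosure q (range a) x ->
  forall eps, 0 < eps -> exists n, `|x - e n| < eps.

(* If [C] has no slice of diameter [<= eps], every point of [C] is a limit of
   convex combinations of points of [C] at distance more than [eps / 2]. *)
Lemma nondentable_approx (C : set V) (eps : R) :
  bounded_set C -> 0 < eps ->
  (forall (phi : {scalar V}) (delta : R),
     continuous (phi : V -> R) -> 0 < delta ->
     exists x y, [/\ slice C phi delta x, slice C phi delta y & eps < `|x - y|]) ->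
  forall a eta, C a -> 0 < eta -> exists s : seq V,
    (forall y, y \in s -> C y /\ eps / 2 < `|a - y|) /\
    exists2 x, `|a - x| < eta &
      forall Z, convexly_closed Z -> (forall y, y \in s -> Z y) -> Z x.
Proof.
move=> [M [Mreal CM]] eps0 bad a eta Ca eta0; apply: contrapT => nex.
pose S := [set y | C y /\ eps / 2 < `|a - y|].
have Sd x : convex_hull S x -> eta <= `|a - x|.
  move=> [s [sS sx]]; rewrite leNgt; apply/negP => xa; apply: nex.
  by exists s; split; [exact: sS|exists x].
have [phi [phile phiS]] :=
  seminorm_separation (@seminorm_norm R V) (@convex_hull_closed _ _ S) Sd.
have phicont : continuous (phi : V -> R).
  by apply: (@dominated_continuous _ _ _ 1) => v; rewrite mul1r.
have phis : has_sup (phi @` C).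
  split; first by exists (phi a); exists a.
  exists (M + 1) => _ [y Cy <-]; apply: le_trans (ler_norm _) _.
  by apply: le_trans (phile _) _; apply: CM => //; rewrite ltrDl.
(* The slice is then [phi > phi a - eta], and separation keeps all points of [C] farther than
   [eps / 2] from [a] out of it, so its diameter is at most [eps]. *)
pose del := sup (phi @` C) - phi a + eta.
have del0 : 0 < del.
  by rewrite /del addrC ltr_pwDl// subr_ge0 sup_upper_bound//; exists a.
have [x [y [[Cx sx] [Cy sy] xy]]] := bad phi del phicont del0.
have near_a z : C z -> sup [set phi x | x in C] - del < phi z -> `|a - z| <= eps / 2.
  move=> Cz sz; rewrite leNgt; apply/negP => az.
  have := phiS z (sub_convex_hull (conj Cz az)).
  by move: sz; rewrite /del; lra.
have := near_a _ Cx sx; have := near_a _ Cy sy.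
have := ler_distD a x y; rewrite (distrC x a); lra.
Qed.

(** The countable set [range a] is stable under rational convex combinations and contains, with each
    point, lists of distant points of [C] whose convex hulls come arbitrarily near that point. A
    slice of [K] by a [q]-continuous functional contains some [a n], hence a nearby convex
    combination, hence a member of the list, at distance more than [eps / 2 = 4 * (eps / 8)]. *)
Theorem abstract_rnp : radon_nikodym_property V.
Proof.
move=> C [c Cc] Cclosed Cbd Cconv eps eps0; apply: contrapT => nslice.
have bad (phi : {scalar V}) (delta : R) :
     continuous (phi : V -> R) -> 0 < delta ->
     exists x y, [/\ slice C phi delta x, slice C phi delta y & eps < `|x - y|].
  move=> phic d0; apply: contrapT => h; apply: nslice; exists phi, delta.
  split => // x y sx sy; rewrite leNgt; apply/negP => xy; apply: h.
  by exists x, y.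
have approx := nondentable_approx Cbd eps0 bad.
have [M CM] : exists M, forall x, C x -> `|x| <= M.
  have [M [Mreal CM]] := Cbd; exists (M + 1) => x Cx.
  by apply: CM => //; rewrite ltrDl.
have Cc' : convexly_closed C.
  move=> x y t t0 t1 Cx Cy.
  have ti : Itv.spec (@Itv.num_sem R) (Itv.Real `[0%Z, 1%Z]) t.
    by rewrite /= /Itv.num_sem/= in_itv/= t0 t1 num_real.
  have := Cconv x y (Itv.mk ti); rewrite !inE => /(_ Cx Cy).
  by [].
have [L LP] : exists L : V -> nat -> seq V, forall a k, C a ->
    (forall y, y \in L a k -> C y /\ eps / 2 < `|a - y|) /\
    exists2 x, `|a - x| < 2^-1 ^+ k &
      forall Z, convexly_closed Z -> (forall y, y \in L a k -> Z y) -> Z x.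
  have /choice[L LP] (ak : V * nat) : exists s : seq V, C ak.1 ->
    (forall y, y \in s -> C y /\ eps / 2 < `|ak.1 - y|) /\
    exists2 x, `|ak.1 - x| < 2^-1 ^+ ak.2 &
      forall Z, convexly_closed Z -> (forall y, y \in s -> Z y) -> Z x.
    have [Ca|nCa] := pselect (C ak.1); last by exists [::].
    have [|s sP] := approx ak.1 (2^-1 ^+ ak.2) Ca; first by rewrite exprn_gt0.
    by exists s.
  by exists (fun a k => L (a, k)) => a k; exact: (LP (a, k)).
(* Choosing a list member ignores the argument [y]; as a binary operation it fits
   [countable_closure] along with the convex combinations. *)
pose F (i : (nat * nat) + rat) (x y : V) : V := match i with
  | inl (k, j) => nth x (L x k) j
  | inr r => if (0 <= ratr r :> R) && (ratr r <= 1 :> R)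
             then ratr r *: x + (1 - ratr r) *: y else x
  end.
have [|a [aC aF]] := @countable_closure _ _ F C c Cc.
  move=> [[k j]|r] x y Cx Cy /=.
    have [jl|jl] := ltnP j (size (L x k)); last by rewrite nth_default.
    by have [/(_ _ (mem_nth x jl))[]] := LP x k Cx.
  by case: ifP => // /andP[r0 r1]; exact: Cc'.
have [e eP] := qsep a.
pose K := qclosure q (range a).
have aK n : K (a n).
  by move=> d d0; exists (a n); [exists n|rewrite subrr seminorm0].
have KM x : K x -> `|x| <= M.
  move=> Kx; apply: qball => d d0; have [_ [n _ <-] nd] := Kx d d0.
  by exists (a n) => //=; exact: CM.
have Kq : qclosure q K `<=` K.
  move=> x hx d d0; have d20 : 0 < d / 2 by rewrite divr_gt0.
  have [y Ky xy] := hx _ d20; have [z Az yz] := Ky _ d20.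
  exists z => //; have := seminorm_triangle sq x y z; lra.
have Kconv : convexly_closed K.
  move=> x y t t0 t1 Kx Ky d d0.
  have d20 : 0 < d / 3 by rewrite divr_gt0.
  have [_ [n _ <-] xn] := Kx _ d20; have [_ [m _ <-] ym] := Ky _ d20.
  have qe (u v : V) (s r : R) :
      q (s *: u + r *: v) <= `|s| * q u + `|r| * q v.
    by apply: le_trans (sq.1 _ _) _; rewrite !sq.2.
  have [->|tn1] := eqVneq t 1.
    by exists (a n); [exists n|rewrite scale1r subrr scale0r addr0; lra].
  have t1' : t < 1 by rewrite lt_neqAle tn1.
  pose D := q (a n - a m) + 1.
  have D0 : 0 < D by rewrite ltr_wpDl// seminorm_ge0.
  have tm : t < Num.min 1 (t + d / 3 / D).
    by rewrite lt_min t1' ltrDl divr_gt0.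
  have [r] := rat_in_itvoo tm.
  rewrite in_itv/= lt_min => /and3P[tr r1 rd].
  have [k] := aF (inr r) n m.
  rewrite /F (ltW (le_lt_trans t0 tr)) (ltW r1)/=.
  move: (ratr r) tr r1 rd => rr tr r1 rd ak.
  exists (a k); first by exists k.
  rewrite ak.
  have -> : t *: x + (1 - t) *: y - (rr *: a n + (1 - rr) *: a m) =
     (t *: (x - a n) + (1 - t) *: (y - a m)) + (t - rr) *: (a n - a m).
    rewrite (scalerBr t) (scalerBr (1 - t)) [in RHS]addrACA -opprD.
    rewrite -[RHS]addrA; congr (_ + _).
    apply: oppr_inj; rewrite opprK [RHS]opprD opprK.
    rewrite -scalerN opprB scalerBr [_ *: a m - _]addrC addrACA -!scaleNr.
    by rewrite -!scalerDl; congr (_ *: _ + _ *: _); ring.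
  have h1 := sq.1 (t *: (x - a n) + (1 - t) *: (y - a m)) ((t - rr) *: (a n - a m)).
  have h2 := qe (x - a n) (y - a m) t (1 - t).
  move: h1 h2; rewrite sq.2 (ger0_norm t0) (@ger0_norm _ (1 - t)); last by lra.
  rewrite (@ltr0_norm _ (t - rr)); last by lra.
  have h3 : (rr - t) * q (a n - a m) <= d / 3 / D * D.
    by apply: ler_pM; [rewrite subr_ge0 ltW|exact: seminorm_ge0|rewrite lerBlDl ltW|rewrite lerDl].
  move: h3; rewrite divfK ?gt_eqF//.
  have h4 : t * q (x - a n) <= t * (d / 3) by rewrite ler_wpM2l// ltW.
  have h5 : (1 - t) * q (y - a m) <= (1 - t) * (d / 3).
    by rewrite ler_wpM2l ?(ltW ym)//; lra.
  lra.
have Kbad (phi : {scalar V}) (lip b : R) :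
  (forall v, `|phi v| <= lip * q v) -> (exists2 x, K x & b < phi x) ->
  exists x y, [/\ K x, K y, b < phi x, b < phi y & 4 * (eps / 8) < `|x - y|].
  move=> phil [x Kx bx].
  have l0 : 0 < `|lip| + 1 by rewrite ltr_wpDl.
  have phil' v : `|phi v| <= (`|lip| + 1) * q v.
    apply: le_trans (phil v) _; rewrite ler_wpM2r ?seminorm_ge0//.
    by rewrite (le_trans (ler_norm _))// lerDl.
  have [|_ [n _ <-] xn] := Kx ((phi x - b) / (`|lip| + 1)).
    by rewrite divr_gt0// subr_gt0.
  have bn : b < phi (a n).
    have h1 := le_trans (ler_norm _) (phil' (x - a n)).
    move: xn; rewrite ltr_pdivlMr// mulrC => h2.
    by move: h1; rewrite raddfB; lra.
  pose c1 := (`|lip| + 1) * `|c0| + 1.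
  have c10 : 0 < c1 by rewrite ltr_wpDl// mulr_ge0// ltW.
  have [|k] := @half_expr_lt R ((phi (a n) - b) / c1).
    by rewrite divr_gt0// subr_gt0.
  rewrite ltr_pdivlMr// => kb.
  have [Lk [z nz zP]] := LP (a n) k (aC n).
  have bz : b < phi z.
    have h1 := le_trans (ler_norm _) (phil' (a n - z)).
    have h2 : q (a n - z) <= `|c0| * 2^-1 ^+ k.
      apply: le_trans (qle _) _; apply: (@le_trans _ _ (`|c0| * `|a n - z|)).
        by rewrite ler_wpM2r// ler_norm.
      by rewrite ler_wpM2l// ltW.
    have h3 := ler_wpM2l (ltW l0) h2.
    have h4 : 0 <= 2^-1 ^+ k :> R by rewrite exprn_ge0.
    by move: h1 kb h3; rewrite raddfB /c1; lra.
  have [y yL by_] : exists2 y, y \in L (a n) k & b < phi y.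
    apply: contrapT => h; move: bz; apply/negP; rewrite -leNgt.
    apply: (zP _ (@convexly_closed_scalar_le _ _ phi b)) => y yL /=.
    by rewrite leNgt; apply/negP => h'; apply: h; exists y.
  have [j jl yE] := nthP (a n) yL.
  have [m am] := aF (inl (k, j)) n n.
  have {}am : a m = y by rewrite am /F yE.
  exists (a n), (a m); split => //; first by rewrite am.
  by rewrite am; have [_] := Lk _ yL; lra.
apply: (@no_countable_cover _ _ q sq qball qcomp quc c0 qle K M (eps / 8) _ _ _ _ _ _ e) => //.
- by exists (a 0%N).
- by rewrite divr_gt0.
- move=> x /eP /(_ (eps / 8))[|n xn]; first by rewrite divr_gt0.
  by exists n; exact: ltW.
Qed.

End abstract.

(** * Bounded cubes *)

Lemma cauchy_seq_limit (R : realType) (V : completeNormedModType R)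
    (u : nat -> V) :
  (forall e, 0 < e -> exists n, forall m, (n <= m)%N -> `|u n - u m| <= e) ->
  exists w, forall e, 0 < e -> exists n, forall m, (n <= m)%N -> `|w - u m| < e.
Proof.
move=> uc.
have cu : cauchy (u @ \oo).
  apply/cauchyP => e e0; have [|n un] := uc (e / 2); first by rewrite divr_gt0.
  exists (u n); exists n => // m /= nm.
  rewrite -ball_normE/=; apply: (@le_lt_trans _ _ (e / 2)); last by lra.
  exact: un.
have /cvg_ex[w uw] : cvg (u @ \oo) by exact: cauchy_cvg.
exists w => e e0; have /cvgrPdist_lt/(_ e e0)[n _ un] := uw.
by exists n => m nm; exact: un.
Qed.

Lemma continuous_scalar_bounded (R : realType) (V : normedModType R)
    (phi : {scalar V}) : continuous (phi : V -> R) ->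
  exists2 L, 0 < L & forall v, `|phi v| <= L * `|v|.
Proof.
move=> phic; have /cvgrPdist_lt/(_ 1 ltr01) := phic 0.
rewrite raddf0 => /nbhs_ballP[r /= r0 rP].
have r20 : 0 < r / 2 by rewrite divr_gt0.
have rP' v : `|v| < r -> `|phi v| < 1.
  move=> vr; have := rP v; rewrite -ball_normE/= !sub0r !normrN; exact.
exists (2 / r) => [|v]; first by rewrite divr_gt0.
have [->|v0] := eqVneq v 0; first by rewrite raddf0 !normr0 mulr0.
have nv : 0 < `|v| by rewrite normr_gt0.
have [a a0 av] : exists2 a, 0 < a & a * `|v| = r / 2.
  by exists (r / 2 / `|v|); rewrite ?divr_gt0// divfK// gt_eqF.
have := rP' (a *: v + 0 *: v).
rewrite (scalar_comb phi) scale0r addr0 mul0r addr0 normrZ normrM (gtr0_norm a0).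
rewrite av => /(_ ltac:(lra)) h.
rewrite -(ler_pM2l a0) mulrCA av; apply: le_trans (ltW h) _.
have -> : 2 / r * (r / 2) = 1 by field; rewrite gt_eqF.
by [].
Qed.

Fixpoint cube_span (R : realType) (V : lmodType R) (u : nat -> V) (n : nat) : set V :=
  if n is m.+1 then
    [set x | exists z (s : R), [/\ cube_span u m z, `|s| <= 1 & x = z + s *: u m]]
  else [set 0].

Section cube_span.
Context (R : realType) (V : normedModType R) (u : nat -> V).

Lemma cube_span0 n : cube_span u n 0.
Proof.
elim: n => //= n IH; exists 0, 0; split => //; first by rewrite normr0.
by rewrite scale0r addr0.
Qed.

Lemma cube_span_le n m x : (n <= m)%N -> cube_span u n x -> cube_span u m x.
Proof.
move=> /subnKC <-; elim: (m - n)%N => [|k IH] nx; first by rewrite addn0.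
rewrite addnS; exists x, 0; split; [exact: IH|by rewrite normr0|].
by rewrite scale0r addr0.
Qed.

Lemma cube_span_convex n : convexly_closed (cube_span u n).
Proof.
move=> x y t t0 t1.
elim: n x y => [|n IH] x y /=.
  by move=> -> ->; rewrite !scaler0 addr0.
move=> [z [s [zn s1 ->]]] [z' [s' [z'n s'1 ->]]].
exists (t *: z + (1 - t) *: z'), (t * s + (1 - t) * s'); split.
- exact: IH.
- apply: le_trans (ler_normD _ _) _; rewrite !normrM (ger0_norm t0).
  rewrite (@ger0_norm _ (1 - t)); last by lra.
  have h1 : t * `|s| <= t * 1 by apply: ler_wpM2l.
  have h2 : (1 - t) * `|s'| <= (1 - t) * 1 by apply: ler_wpM2l => //; lra.
  lra.
- by rewrite [(t * s + _) *: _]scalerDl -!scalerA addrACA -!scalerDr.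
Qed.

End cube_span.

(* The image of the unit ball of c_00 has no small slices, because a bounded
   functional is small on [u k] for [k] large. *)
Lemma not_rnp_of_bounded_cube (R : realType) (V : completeNormedModType R)
    (u : nat -> V) (B e : R) : 0 < e ->
  (forall k, e < `|u k|) -> (forall n x, cube_span u n x -> `|x| <= B) ->
  ~ radon_nikodym_property V.
Proof.
move=> e0 ue uB rnp.
pose A := \bigcup_n cube_span u n.
have clP x : closure A x <-> forall d, 0 < d -> exists2 y, A y & `|x - y| < d.
  split=> [Ax d d0|h U /nbhs_ballP[d /= d0 dU]].
    have [|y [Ay xy]] := Ax (ball x d); first exact: nbhsx_ballx.
    by exists y => //; move: xy; rewrite -ball_normE.
  by have [y Ay xy] := h d d0; exists y; split => //; apply: dU; rewrite -ball_normE.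
have clB x : closure A x -> `|x| <= B.
  move=> /clP h; apply/ler_addgt0Pr => d d0; have [y [n _ yn] xy] := h d d0.
  have := ler_normD (x - y) y; rewrite subrK; have := uB _ _ yn; lra.
have Acl x : A x -> closure A x by apply: subset_closure.
have clconv : convex_set (closure A).
  move=> x y lam; rewrite !inE => /clP Ax /clP Ay; apply/clP => d d0.
  have [x' [n _ x'n] xx'] := Ax d d0; have [y' [m _ y'm] yy'] := Ay d d0.
  pose t : R := lam%:num.
  have t0 : 0 <= t by rewrite /t; exact: ge0.
  have t1 : t <= 1 by rewrite /t; exact: le1.
  exists (t *: x' + (1 - t) *: y').
    exists (maxn n m) => //; apply: cube_span_convex => //.
      by apply: cube_span_le x'n; exact: leq_maxl.
    by apply: cube_span_le y'm; exact: leq_maxr.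
  rewrite [X in `|X|](_ : _ = t *: (x - x') + (1 - t) *: (y - y')); last first.
    by rewrite !scalerBr [RHS]addrACA -opprD.
  have h := seminorm_norm V.
  apply: le_lt_trans (h.1 _ _) _; rewrite !normrZ (ger0_norm t0).
  rewrite (@ger0_norm _ (1 - t)); last by lra.
  have [->|tn1] := eqVneq t 1; first by rewrite subrr mul0r addr0 mul1r.
  have t1' : 0 < 1 - t by rewrite subr_gt0 lt_neqAle tn1.
  have h1 : t * `|x - x'| <= t * d by rewrite ler_wpM2l// ltW.
  have h2 : (1 - t) * `|y - y'| < (1 - t) * d by rewrite ltr_pM2l.
  lra.
have [|||phi [del [phic del0 slP]]] := rnp (closure A) _ _ _ clconv e e0.
- by exists 0; apply: Acl; exists 0%N.
- exact: closed_closure.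
- by exists B; split; [exact: num_real|move=> M BM x /clB xB; exact: le_trans xB (ltW BM)].
have [L L0 phiL] := continuous_scalar_bounded phic.
set S := sup (phi @` closure A).
have phiB x : closure A x -> phi x <= L * B.
  move=> /clB xB; apply: le_trans (ler_norm _) _; apply: le_trans (phiL _) _.
  by rewrite ler_wpM2l// ltW.
have Ssup : has_sup (phi @` closure A).
  split; first by exists (phi 0); exists 0 => //; apply: Acl; exists 0%N.
  by exists (L * B) => _ [x Ax <-]; exact: phiB.
have [_ [x /clP Ax <-] xS] := sup_adherent del0 Ssup.
have [|z [n _ zn] xz] := Ax ((phi x - (S - del)) / L).
  by rewrite divr_gt0// subr_gt0.
have zS : S - del < phi z.
  have h := le_trans (ler_norm _) (phiL (x - z)).
  move: xz; rewrite ltr_pdivlMr// mulrC => xz.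
  by move: h; rewrite raddfB; lra.
pose eta := phi z - (S - del).
have eta0 : 0 < eta by rewrite subr_gt0.
have [k nk ketta] : exists2 k, (n <= k)%N & `|phi (u k)| < eta.
  (* Otherwise, adding up [m] of the vectors with the signs of [phi (u k)] stays in the cube and
     brings [phi] to at least [m * eta], beyond its bound [L * B] there. *)
  apply: contrapT => nk.
  have big k : (n <= k)%N -> eta <= `|phi (u k)|.
    by move=> h; rewrite leNgt; apply/negP => h'; apply: nk; exists k.
  have [w wP] : exists w : nat -> V, forall m,
      cube_span u (n + m)%N (w m) /\ m%:R * eta <= phi (w m).
    suff /choice[w wP] : forall m, exists w,
      cube_span u (n + m)%N w /\ m%:R * eta <= phi w by exists w.
    elim=> [|m [w [wn wm]]].
      by exists 0; split; [exact: cube_span0|rewrite (raddf0 phi) mul0r].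
    exists (w + Num.sg (phi (u (n + m)%N)) *: u (n + m)%N); split.
      rewrite addnS; exists w, (Num.sg (phi (u (n + m)%N))); split => //.
      by rewrite normr_sg; case: (_ == _).
    rewrite -[w]scale1r (scalar_comb phi) mul1r -normrEsg -natr1 mulrDl mul1r.
    by apply: lerD => //; apply: big; exact: leq_addr.
  have [m mP] : exists m : nat, L * B < m%:R * eta.
    exists (Num.truncn (L * B / eta)).+1; rewrite -ltr_pdivrMr//.
    exact: truncnS_gt.
  have [wn wm] := wP m.
  have : phi (w m) <= L * B by apply/phiB/Acl; exists (n + m)%N.
  lra.
have zk (s : R) : `|s| = 1 -> slice (closure A) phi del (z + s *: u k).
  move=> s1; split.
    apply: Acl; exists k.+1 => //; exists z, s; split; [|by rewrite s1|by []].
    exact: cube_span_le zn.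
  rewrite -/S -[z]scale1r (scalar_comb phi) mul1r.
  have : - `|phi (u k)| <= s * phi (u k).
    by rewrite lerNl; apply: le_trans (ler_norm _) _; rewrite normrN normrM s1 mul1r.
  by move: ketta; rewrite /eta; lra.
have := slP _ _ (zk 1 (normr1 _)) (zk (-1) (normrN1 _)).
rewrite scale1r scaleN1r opprB [u k - z]addrC addrACA subrr add0r.
rewrite -mulr2n -scaler_nat.
rewrite normrZ gtr0_norm//.
by have := ue k; lra.
Qed.

(** * Elements of a lattice as functions *)

Lemma filterS4 (T : Type) (F : set_system T) : Filter F ->
  forall P Q Q' Q'' S : set T, (forall x, P x -> Q x -> Q' x -> Q'' x -> S x) ->
  F P -> F Q -> F Q' -> F Q'' -> F S.
Proof.
move=> FF P Q Q' Q'' S PS FP FQ FQ' FQ''.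
by apply: filterS2 (filterI FP FQ) (filterI FQ' FQ'') => x [? ?] [? ?]; exact: PS.
Qed.

Lemma filterS5 (T : Type) (F : set_system T) : Filter F ->
  forall P Q Q' Q'' Q3 S : set T,
  (forall x, P x -> Q x -> Q' x -> Q'' x -> Q3 x -> S x) ->
  F P -> F Q -> F Q' -> F Q'' -> F Q3 -> F S.
Proof.
move=> FF P Q Q' Q'' Q3 S PS FP FQ FQ' FQ'' FQ3.
by apply: filterS3 (filterI FP FQ) (filterI FQ' FQ'') FQ3 => x [? ?] [? ?]; exact: PS.
Qed.

Section L0.
Context d (T : measurableType d) (R : realType) (mu : {measure set T -> \bar R}).

Lemma measurable_L0 (f : L0 mu) : measurable_fun setT (f : T -> R).
Proof. exact: measurable_funPT. Qed.

Lemma L0_of (f : T -> R) : measurable_fun setT f ->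
  exists F : L0 mu, \forall t \ae mu, F t = f t.
Proof.
move=> mf; pose g : {mfun T >-> R} := HB.pack f (isMeasurableFun.Build _ _ _ _ f mf).
by exists (L0_class mu g); exact: (L0_classE mu g).
Qed.

End L0.

Section lattice.
Context d (T : measurableType d) (R : realType) (mu : {measure set T -> \bar R}).
Variable X : banachFunctionLattice mu.
Implicit Types (x y z : X) (f g : T -> R).

Definition rep x : T -> R := (bfl_val X x : L0 mu).

Lemma measurable_rep x : measurable_fun setT (rep x).
Proof. exact: measurable_L0. Qed.

Lemma rep_inj x y : (\forall t \ae mu, rep x t = rep y t) -> x = y.
Proof. by move=> xy; apply: (@bfl_val_inj _ _ _ _ X); apply/L0_eqP. Qed.

Lemma repD x y : \forall t \ae mu, rep (x + y) t = rep x t + rep y t.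
Proof. rewrite /rep raddfD; exact: L0_addE. Qed.

Lemma repN x : \forall t \ae mu, rep (- x) t = - rep x t.
Proof. rewrite /rep raddfN; exact: L0_oppE. Qed.

Lemma repB x y : \forall t \ae mu, rep (x - y) t = rep x t - rep y t.
Proof.
by have := repD x (- y); apply: filterS2 (repN y) => t -> ->.
Qed.

Lemma repZ a x : \forall t \ae mu, rep (a *: x) t = a * rep x t.
Proof. rewrite /rep linearZ_LR; exact: L0_scaleE. Qed.

Lemma rep0 : \forall t \ae mu, rep 0 t = 0.
Proof. rewrite /rep raddf0; exact: L0_zeroE. Qed.

Lemma ideal_val (F : L0 mu) x : (\forall t \ae mu, `|F t| <= `|rep x t|) ->
  exists2 y, bfl_val X y = F & `|y| <= `|x|.
Proof. exact: bfl_ideal. Qed.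

Lemma ideal_rep f x : measurable_fun setT f ->
  (\forall t \ae mu, `|f t| <= `|rep x t|) ->
  exists2 y, \forall t \ae mu, rep y t = f t & `|y| <= `|x|.
Proof.
move=> /(@L0_of _ _ _ mu)[F Ff] fx.
have [|y yF yx] := @ideal_val F x; first by apply: filterS2 Ff fx => t ->.
by exists y => //; rewrite /rep yF.
Qed.

Lemma norm_rep_le x y : (\forall t \ae mu, `|rep x t| <= `|rep y t|) ->
  `|x| <= `|y|.
Proof.
move=> xy; have [z zx zy] := ideal_val xy.
by rewrite -(bfl_val_inj zx).
Qed.

(** The negative part of [x] is dominated by [|x - z|] for each positive [z], hence its norm is
    0. *)
Lemma rep_ge0_closed x :
  (forall e, 0 < e -> exists2 z, \forall t \ae mu, 0 <= rep z t & `|x - z| <= e) ->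
  \forall t \ae mu, 0 <= rep x t.
Proof.
move=> xz.
have [||y yx _] := @ideal_rep (fun t => Num.min (rep x t) 0) x.
- by apply: measurable_minr => //; exact: measurable_rep.
- by apply: nearW => t; case: (leP (rep x t) 0) => h //; rewrite normr0.
suff y0 : y = 0.
  rewrite {}y0 in yx; apply: filterS2 yx rep0 => t -> /eqP.
  by rewrite minElt; case: (ltP (rep x t) 0) => // h /eqP h'; rewrite h' ltxx in h.
apply/eqP; rewrite -normr_le0; apply/ler_addgt0Pr => e e0; rewrite add0r.
have [z z0 xze] := xz _ e0; apply: le_trans xze; apply: norm_rep_le.
apply: filterS3 yx z0 (repB x z) => t -> z0 ->.
case: (leP (rep x t) 0) => h; last by rewrite normr0.
by rewrite !ler0_norm; lra.
Qed.

Lemma bfl_normE x : bfl_norm X (bfl_val X x) = `|x|%:E.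
Proof.
rewrite /bfl_norm [X in ereal_inf X](_ : _ = [set `|x|%:E]) ?ereal_inf1//.
apply/seteqP; split=> [_ [y /= yx <-]|_ ->]; last by exists x.
by rewrite (bfl_val_inj yx).
Qed.

Lemma bfl_norm_range (F : L0 mu) : (bfl_norm X F < +oo)%E -> range (bfl_val X) F.
Proof.
rewrite /bfl_norm; have [/set0P[_ [x /= xF _]] _|/negPn/eqP ->] :=
  boolP ([set `|x|%:E | x in [set x : X | bfl_val X x = F]] != set0).
  by exists x.
by rewrite ereal_inf0 ltxx.
Qed.

(* Differences [y n - y m] of a decreasing sequence that is not Cauchy supply
   a cube: positive blocks of norm bounded below with sums dominated by [y 0]. *)
Lemma rnp_decreasing (y : nat -> X) : radon_nikodym_property X ->
  (forall n, \forall t \ae mu, 0 <= rep (y n) t) ->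
  (forall n m, (n <= m)%N -> \forall t \ae mu, rep (y m) t <= rep (y n) t) ->
  (\forall t \ae mu, rep (y n) t @[n --> \oo] --> (0 : R)) ->
  forall e, 0 < e -> exists n, `|y n| < e.
Proof.
move=> rnp y0 ymono ycvg.
have ycauchy e : 0 < e -> exists n, forall m, (n <= m)%N -> `|y n - y m| <= e.
  move=> e0; apply: contrapT => nc.
  have /choice[h hP] n : exists m, (n <= m)%N /\ e < `|y n - y m|.
    apply: contrapT => h; apply: nc; exists n => m nm.
    by rewrite leNgt; apply/negP => h'; apply: h; exists m.
  pose k n := iter n h 0%N.
  pose u n := y (k n) - y (k n.+1).
  apply: (@not_rnp_of_bounded_cube _ _ u `|y 0%N| e) rnp => //.
    by move=> n; have [] := hP (k n).
  move=> n x xn; apply: norm_rep_le.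
  (* This sharper bound makes the induction work: the blocks telescope to [y 0 - y (k n)]. *)
  suff : \forall t \ae mu, `|rep x t| <= rep (y 0%N) t - rep (y (k n)) t.
    apply: filterS3 (y0 0%N) (y0 (k n)) => t h1 h2 h3.
    by apply: le_trans h3 _; rewrite (ger0_norm h1); lra.
  elim: n x xn => [|n IH] x /=.
    by move=> ->; apply: filterS rep0 => t ->; rewrite normr0 subrr.
  move=> [z [s [zn s1 ->]]].
  have kn : (k n <= k n.+1)%N by have [] := hP (k n).
  move: (IH _ zn) (repD z (s *: u n)) (repZ s (u n)) (repB (y (k n)) (y (k n.+1))).
  move: (ymono _ _ kn); apply: filterS5 => t h1 h2 -> -> h3.
  apply: le_trans (ler_normD _ _) _; rewrite normrM [u n]/(y _ - y _) h3.
  rewrite (@ger0_norm _ (_ - _)) ?subr_ge0//.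
  have : `|s| * (rep (y (k n)) t - rep (y (k n.+1)) t) <=
     1 * (rep (y (k n)) t - rep (y (k n.+1)) t).
    by rewrite ler_wpM2r// subr_ge0.
  lra.
have [w wP] := cauchy_seq_limit ycauchy.
(* The norm limit is compared with the almost everywhere limit through the order alone:
   [0 <= w <= y n], and the right-hand side tends to 0 almost everywhere. *)
have w0 : \forall t \ae mu, 0 <= rep w t.
  apply: rep_ge0_closed => e /wP[n /(_ n (leqnn n)) wn].
  by exists (y n) => //; exact: ltW.
have wy n : \forall t \ae mu, 0 <= rep (y n - w) t.
  apply: rep_ge0_closed => e /wP[m /(_ _ (leq_maxl m n)) wn].
  exists (y n - y (maxn m n)).
    apply: filterS2 (repB (y n) (y (maxn m n))) (ymono _ _ (leq_maxr m n)) => t -> h.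
    by rewrite subr_ge0.
  by rewrite opprB addrC addrA subrK distrC; exact: ltW.
have w00 : w = 0.
  apply: rep_inj.
  have : \forall t \ae mu, forall n, 0 <= rep (y n) t - rep w t.
    apply/ae_foralln => n; apply: filterS2 (wy n) (repB (y n) w) => t h <-.
    exact: h.
  move: rep0 w0 ycvg; apply: filterS4 => t -> h1 h3 h2.
  apply/le_anti; rewrite h1 andbT.
  rewrite leNgt; apply/negP => wt.
  have /cvgrPdist_lt/(_ _ wt)[n _ /(_ n (leqnn n))] := h3.
  rewrite sub0r normrN => h4; have := h2 n.
  by have := le_lt_trans (ler_norm _) h4; lra.
move=> e /wP[n /(_ n (leqnn n))]; rewrite w00 sub0r normrN; by exists n.
Qed.

End lattice.

(** * Order continuity and convergence theorems in the lattice *)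

Section order_continuity.
Context d (T : measurableType d) (R : realType) (mu : {measure set T -> \bar R}).
Variable X : banachFunctionLattice mu.
Implicit Types (x y z : X) (f g : T -> R).

Theorem rnp_order_continuous : radon_nikodym_property X -> order_continuous X.
Proof.
move=> rnp; apply/seteqP; split=> [F [/bfl_norm_range]//|_ [x _ <-]].
split; first by rewrite bfl_normE ltry.
move=> g gx gdec.
have /choice[y yg] n : exists y, bfl_val X y = g n.
  have [|y <- _] := @ideal_val _ _ _ _ X (g n) x; last by exists y.
  by apply: filterS (gx n) => t /andP[g0 gxt]; rewrite ger0_norm.
have gE : bfl_norm X \o g = fun n => `|y n|%:E.
  by apply/funext => n; rewrite /= -yg bfl_normE.
have y0 n : \forall t \ae mu, 0 <= rep (y n) t.
  by apply: filterS (gx n) => t /andP[]; rewrite /rep yg.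
have ymono n m : (n <= m)%N -> \forall t \ae mu, rep (y m) t <= rep (y n) t.
  by move=> nm; apply: filterS gdec => t [/(_ _ _ nm) + _]; rewrite /rep !yg.
have nmono n m : (n <= m)%N -> `|y m| <= `|y n|.
  move=> nm; apply: norm_rep_le; apply: filterS3 (ymono _ _ nm) (y0 n) (y0 m).
  by move=> t h1 h2 h3; rewrite !ger0_norm.
split; first by rewrite gE => n m nm; rewrite lee_fin nmono.
rewrite -[X in X @ \oo --> _]/(bfl_norm X \o g) gE.
apply: cvg_EFin; first exact: nearW.
apply/cvgrPdist_lt => e e0.
have [|n yn] := rnp_decreasing rnp y0 ymono _ e0.
  by apply: filterS gdec => t [_]; under eq_fun do rewrite -yg.
exists n => // m /= nm; rewrite sub0r normrN normr_id.
exact: le_lt_trans (nmono _ _ nm) yn.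
Qed.

(** Dominated convergence: the tail suprema of [|u n|] decrease to 0 below [|y|], so order
    continuity applies to them. *)
Lemma order_continuous_dominated (u : nat -> X) y : order_continuous X ->
  (forall n, \forall t \ae mu, `|rep (u n) t| <= `|rep y t|) ->
  (\forall t \ae mu, rep (u n) t @[n --> \oo] --> (0 : R)) ->
  forall e, 0 < e -> exists n, forall m, (n <= m)%N -> `|u m| < e.
Proof.
move=> oc uy u0 e e0.
(* The cap changes [|rep (u n) t|] on a null set only, but makes the tail suprema finite at every
   point. *)
pose h n t := Num.min `|rep (u n) t| `|rep y t|.
have mh n : measurable_fun setT (h n).
  apply: measurable_minr; apply: measurableT_comp => //; exact: measurable_rep.
have h0 n t : 0 <= h n t by rewrite le_min !normr_ge0.
have hub t : has_ubound (range (h ^~ t)).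
  by exists `|rep y t| => _ [n _ <-]; rewrite ge_min lexx orbT.
have hsub t n : has_ubound (sdrop (h ^~ t) n) by exact: has_ubound_sdrop.
pose s n t := sups (h ^~ t) n.
have s0 n t : 0 <= s n t.
  by apply: le_trans (h0 n t) _; apply: ub_le_sup => //; exists n => /=.
have sy n t : s n t <= `|rep y t|.
  apply: ge_sup; first by exists (h n t); exists n => /=.
  by move=> _ [k _ <-]; rewrite ge_min lexx orbT.
have ms n : measurable_fun setT (s n) by apply: measurable_fun_sups.
have /choice[S SE] n := L0_of mu (ms n).
have : range (bfl_val X) (bfl_val X y) by exists y.
rewrite -oc => -[_ /(_ S)[||_ Scvg]].
- by move=> n; apply: filterS (SE n) => t ->; rewrite s0 sy.
- move: (ae_foralln SE) (ae_foralln uy) u0; apply: filterS3 => t St ut u0t; split.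
    by move=> n m nm; rewrite !St; apply: nonincreasing_sups.
  have -> : (fun n => S n t) = sups (h ^~ t) by apply/funext => n; rewrite St.
  apply: cvg_sups; have := cvg_norm u0t; rewrite normr0.
  have -> : h ^~ t = (fun n => `|rep (u n) t|).
    by apply/funext => n; rewrite /h min_l.
  exact.
have /choice[w wS] n : exists w, bfl_val X w = S n.
  have [|w <- _] := @ideal_val _ _ _ _ X (S n) y; last by exists w.
  by apply: filterS (SE n) => t ->; rewrite ger0_norm.
move: Scvg; under eq_fun do rewrite -wS bfl_normE.
move=> /fine_cvgP[_] /cvgrPdist_lt/(_ e e0)[n _ nw].
exists n => m nm; have := nw m nm; rewrite /= sub0r normrN normr_id.
apply: le_lt_trans; apply: norm_rep_le.
apply: filterS2 (uy m) (SE m) => t h1 h2; rewrite [rep (w m) _]/rep wS h2 [leRHS]ger0_norm//.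
apply: (@le_trans _ _ (h m t)); first by rewrite /h min_l.
by apply: ub_le_sup => //; exists m => /=.
Qed.

(** The tail infima of [|u n|] increase to [|f|] and have norm at most [M], so the Fatou property
    applies to them; the ideal property then passes from [|f|] to [f]. *)
Lemma fatou_ae_limit (u : nat -> X) f (M : R) : fatou_property X ->
  measurable_fun setT f -> (forall n, `|u n| <= M) ->
  (\forall t \ae mu, rep (u n) t @[n --> \oo] --> f t) ->
  exists2 x : X, \forall t \ae mu, rep x t = f t & `|x| <= M.
Proof.
move=> fp mf uM uf.
pose h n t := `|rep (u n) t|.
have mh n : measurable_fun setT (h n).
  apply: measurableT_comp => //; exact: measurable_rep.
have hlb t : has_lbound (range (h ^~ t)).
  by exists 0 => _ [n _ <-]; exact: normr_ge0.
pose s n t := infs (h ^~ t) n.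
have hsub t n : has_lbound (sdrop (h ^~ t) n) by exact: has_lbound_sdrop.
have s0 n t : 0 <= s n t.
  apply: lb_le_inf; first by exists (h n t); exists n => /=.
  by move=> _ [k _ <-]; exact: normr_ge0.
have sh n t : s n t <= h n t by apply: ge_inf => //; exists n => /=.
have ms n : measurable_fun setT (s n) by apply: measurable_fun_infs.
have /choice[y yP] n : exists y : X, (\forall t \ae mu, rep y t = s n t) /\ `|y| <= M.
  have [|y ys yu] := @ideal_rep _ _ _ _ X (s n) (u n) (ms n).
    by apply: nearW => t; rewrite ger0_norm.
  by exists y; split => //; exact: le_trans yu (uM n).
have [|F FE] := @L0_of _ _ _ mu (fun t => `|f t|); first exact: measurableT_comp.
have [|||x [xF _ ycvg]] := fp y F.
- by exists M => _ [n _ <-]; have [] := yP n.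
- move=> n; have [h1 _] := yP n; apply: filterS h1 => t h1.
  by rewrite [X in 0 <= X](_ : _ = rep (y n) t)// h1.
- have ys : \forall t \ae mu, forall n, rep (y n) t = s n t.
    by apply: ae_foralln => n; have [] := yP n.
  move: ys FE uf; apply: filterS3 => t yt Ft uft; split.
    move=> n m nm; have e k : L0_fun (bfl_val X (y k)) t = s k t by exact: yt.
    by rewrite !e; exact: (nondecreasing_infs (hlb t) nm).
  have -> : (fun n => L0_fun (bfl_val X (y n)) t) = infs (h ^~ t).
    by apply/funext => n; exact: yt.
  by rewrite Ft; apply: cvg_infs; exact: cvg_norm.
have xM : `|x| <= M.
  have <- := cvg_lim (@norm_hausdorff _ _) ycvg.
  apply: limr_le; first by apply/cvg_ex; exists `|x|.
  by apply: nearW => n; have [] := yP n.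
have [|z zf zx] := @ideal_rep _ _ _ _ X f x mf.
  by apply: filterS FE => t; rewrite /rep xF => ->; rewrite normr_id.
by exists z => //; exact: le_trans zx xM.
Qed.

End order_continuity.

(** * Integration *)

Section geometric.
Variable R : realType.

Lemma geometric_sum4_le (n : nat) :
  \sum_(0 <= k < n) (4^-1 : R) ^+ k <= 2.
Proof.
have -> : \sum_(0 <= k < n) (4^-1 : R) ^+ k = 4 / 3 * (1 - 4^-1 ^+ n).
  elim: n => [|n IH]; first by rewrite big_nil expr0 subrr mulr0.
  by rewrite big_nat_recr//= IH exprS; field.
have : 0 <= (4^-1 : R) ^+ n by apply: exprn_ge0; lra.
lra.
Qed.

(* The constant 2 bounds the geometric series [sum 4^-k = 4/3]. *)
Lemma fast_cauchy_limit (u : nat -> R) (K : R) :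
  (forall n, `|u n.+1 - u n| <= K * 4^-1 ^+ n) ->
  exists l, u n @[n --> \oo] --> l /\ forall n, `|u n - l| <= 2 * K * 4^-1 ^+ n.
Proof.
move=> uK.
have q0 n : 0 <= (4^-1 : R) ^+ n by apply: exprn_ge0; lra.
have K0 : 0 <= K.
  by have := uK 0%N; rewrite expr0 mulr1; apply: le_trans.
have dist n m : (n <= m)%N -> `|u n - u m| <= 2 * K * 4^-1 ^+ n.
  move=> /subnKC <-; set k := (m - n)%N.
  suff : `|u n - u (n + k)%N| <= K * 4^-1 ^+ n * \sum_(0 <= j < k) 4^-1 ^+ j.
    move=> h; apply: le_trans h _; rewrite [leRHS](_ : _ = K * 4^-1 ^+ n * 2); last by ring.
    by apply: ler_wpM2l; [exact: mulr_ge0|exact: geometric_sum4_le].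
  elim: k => [|k IH]; first by rewrite addn0 subrr normr0 big_nil mulr0.
  rewrite big_nat_recr//= mulrDr addnS.
  apply: le_trans (ler_distD (u (n + k)%N) _ _) _; apply: lerD => //.
  by rewrite distrC -mulrA -exprD.
have uc e : 0 < e -> exists n, forall m, (n <= m)%N -> `|u n - u m| <= e.
  move=> e0; have [|n nP] := @half_expr_lt R (e / (2 * K + 1)).
    by rewrite divr_gt0//; lra.
  exists n => m /dist h; apply: le_trans h _.
  have hn : (4^-1 : R) ^+ n <= 2^-1 ^+ n by apply: lerXn2r; rewrite ?nnegrE; lra.
  move: nP; rewrite ltr_pdivlMr; last lra.
  have := ler_wpM2l K0 hn; have : 0 <= (2^-1 : R) ^+ n by exact: exprn_ge0.
  by move: (2^-1 ^+ n) (4^-1 ^+ n) => a b; lra.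
have [l lP] : exists l : R, forall e, 0 < e ->
    exists n, forall m, (n <= m)%N -> `|l - u m| < e.
  exact: (@cauchy_seq_limit R R^o u uc).
exists l; split.
  by apply/cvgrPdist_lt => e /lP[n nP]; exists n => // m /= /nP.
move=> n; apply/ler_addgt0Pr => e /lP[m /(_ (maxn n m) (leq_maxr _ _)) ml].
have := dist n (maxn n m) (leq_maxl _ _).
have := ler_distD (u (maxn n m)) (u n) l.
by rewrite distrC in ml; move: (2 * K * 4^-1 ^+ n) => b; lra.
Qed.

End geometric.

Section integration.
Context d (T : measurableType d) (R : realType) (mu : {measure set T -> \bar R}).
Implicit Types f g : T -> R.

Definition integ f := mu.-integrable setT (EFin \o f).

Lemma integ_measurable f : integ f -> measurable_fun setT f.
Proof. by move=> /measurable_int; exact: (measurable_EFinP _ _).1. Qed.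

Lemma integP f : integ f <->
  measurable_fun setT f /\ (\int[mu]_t `|f t|%:E < +oo)%E.
Proof.
split=> [h|[mf h]].
  by split; [exact: integ_measurable|have /integrableP[] := h].
by apply/integrableP; split => //; exact: measurableT_comp.
Qed.

Lemma integ_le_ae f g : measurable_fun setT f ->
  (\forall t \ae mu, `|f t| <= `|g t|) -> integ g -> integ f.
Proof.
move=> mf fg /integP[mg goo]; apply/integP; split => //.
apply: le_lt_trans goo; apply: ae_ge0_le_integral => //.
- by apply/measurable_EFinP; exact: measurableT_comp.
- by apply/measurable_EFinP; exact: measurableT_comp.
- by apply: filterS fg => t h _; rewrite lee_fin.
Qed.

Lemma integ_le f g : measurable_fun setT f ->
  (forall t, `|f t| <= `|g t|) -> integ g -> integ f.
Proof. by move=> mf fg; apply: integ_le_ae => //; exact: nearW. Qed.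

Lemma integD f g : integ f -> integ g -> integ (fun t => f t + g t).
Proof. by move=> fi gi; exact: (integrableD _ fi gi). Qed.

Lemma integZ a f : integ f -> integ (fun t => a * f t).
Proof. by move=> fi; exact: (integrableZl _ a fi). Qed.

Lemma ae_eq_Rint f g : measurable_fun setT f -> measurable_fun setT g ->
  (\forall t \ae mu, f t = g t) -> \int[mu]_t f t = \int[mu]_t g t.
Proof.
move=> mf mg fg; congr fine; apply: ae_eq_integral => //.
- exact/measurable_EFinP.
- exact/measurable_EFinP.
- by apply: filterS fg => t -> _.
Qed.

Lemma Rint_le_ae f g : integ f -> integ g ->
  (\forall t \ae mu, f t <= g t) -> \int[mu]_t f t <= \int[mu]_t g t.
Proof.
move=> fi gi fg.
have mf := integ_measurable fi; have mg := integ_measurable gi.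
pose h t := Num.min (f t) (g t).
have fh : \forall t \ae mu, f t = h t by apply: filterS fg => t; rewrite /h => /min_l ->.
have mh : measurable_fun setT h by exact: measurable_minr.
rewrite (ae_eq_Rint mf mh fh); apply: le_Rintegral => //.
  by apply: integ_le_ae fi => //; apply: filterS fh => t ->.
by move=> t _; rewrite /h ge_min lexx orbT.
Qed.

Lemma Rint_le f g : integ f -> integ g ->
  (forall t, f t <= g t) -> \int[mu]_t f t <= \int[mu]_t g t.
Proof. by move=> fi gi fg; apply: Rint_le_ae => //; exact: nearW. Qed.

Lemma EFin_Rint f : integ f -> (\int[mu]_t f t)%:E = (\int[mu]_t (f t)%:E)%E.
Proof. by move=> fi; rewrite fineK//; exact: integrable_fin_num. Qed.

Lemma integ_of_bound f (B : R) : measurable_fun setT f -> (forall t, 0 <= f t) ->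
  (\int[mu]_t (f t)%:E <= B%:E)%E -> integ f /\ \int[mu]_t f t <= B.
Proof.
move=> mf f0 fB.
have fi : integ f.
  apply/integP; split => //; under eq_integral do rewrite ger0_norm//.
  exact: le_lt_trans fB (ltry _).
by split => //; rewrite -lee_fin EFin_Rint.
Qed.

Lemma fatou_bound (u : nat -> T -> R) f (B : R) :
  (forall n, integ (u n)) -> (forall n t, 0 <= u n t) ->
  measurable_fun setT f -> (forall t, 0 <= f t) ->
  (\forall t \ae mu, u n t @[n --> \oo] --> f t) ->
  (forall n, \int[mu]_t u n t <= B) -> integ f /\ \int[mu]_t f t <= B.
Proof.
move=> ui u0 mf f0 uf uB; apply: integ_of_bound => //.
have mu_ n : measurable_fun setT (EFin \o u n).
  by apply/measurable_EFinP; exact: integ_measurable.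
rewrite (@ge0_ae_eq_integral _ _ _ _ _ _ (fun t => limn_einf (fun n => (u n t)%:E)))//.
- apply: (le_trans (fatou _ _ _ _)) => //.
    by move=> n t _; rewrite lee_fin.
  rewrite limn_einf_lim; apply: lime_le; first exact: is_cvg_einfs.
  apply: nearW => n; apply: (@le_trans _ _ (\int[mu]_x (u n x)%:E)%E).
    by apply: ereal_inf_lbound; exists n => /=.
  by rewrite -EFin_Rint// lee_fin.
- exact/measurable_EFinP.
- apply: measurableT_comp => //; apply: measurable_fun_limn_esup => n.
  exact: (measurableT_comp (@oppe_measurable R setT) (mu_ n)).
- by move=> t _; rewrite lee_fin.
- move=> t _; rewrite limn_einf_lim; apply: lime_ge; first exact: is_cvg_einfs.
  apply: nearW => n; apply: le_ereal_inf_tmp => _ [k _ <-].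
  by rewrite lee_fin.
- apply: filterS uf => t ut _.
  have h : (u n t)%:E @[n --> \oo] --> (f t)%:E by apply: cvg_EFin => //; exact: nearW.
  by have [-> _] := cvg_limn_einf_sup h.
Qed.

Lemma measurable_limit (u : nat -> T -> R) : (forall n, measurable_fun setT (u n)) ->
  exists2 f : T -> R, measurable_fun setT f &
    forall t (l : R), u n t @[n --> \oo] --> l -> f t = l.
Proof.
move=> mu_; exists (fun t => fine (limn_esup (fun n => (u n t)%:E))).
  apply: measurableT_comp => //; apply: measurable_fun_limn_esup => n.
  exact/measurable_EFinP.
move=> t l ut.
have h : (u n t)%:E @[n --> \oo] --> l%:E by apply: cvg_EFin => //; exact: nearW.
by have [_ ->] := cvg_limn_einf_sup h.
Qed.

(** The series of [4 ^+ n * (|u n| * W)] has integral at most the sum of [c * 2^-1 ^+ n]; where it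
    is finite, its sum divided by [W t] serves as [K]. *)
Lemma fast_ae (u : nat -> T -> R) (W : T -> R) (c : R) :
  (forall t, 0 < W t) ->
  (forall n, integ (fun t => `|u n t| * W t)) ->
  (forall n, \int[mu]_t (`|u n t| * W t) <= c * 8^-1 ^+ n) ->
  \forall t \ae mu, exists K, forall n, `|u n t| <= K * 4^-1 ^+ n.
Proof.
move=> W0 ui uc.
pose g n t := (4 ^+ n * (`|u n t| * W t))%:E.
have g0 n t : (0 <= g n t)%E by rewrite lee_fin !mulr_ge0// ltW.
have gi n : integ (fun t => 4 ^+ n * (`|u n t| * W t)) by exact: integZ.
have c0 : 0 <= c.
  have := uc 0%N; rewrite expr0 mulr1; apply: le_trans.
  by apply: Rintegral_ge0 => t _; rewrite mulr_ge0// ltW.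
have mg n : measurable_fun setT (g n) by exact: measurable_int (gi n).
have gle : (\int[mu]_t (\sum_(n <oo) g n t) <= (2 * c)%:E)%E.
  rewrite integral_nneseries//.
  apply: (@le_trans _ _ (\sum_(n <oo) ((2 * c) / (2 ^ n.+1)%:R)%:E)%E); last first.
    by apply: epsilon_trick0; rewrite mulr_ge0.
  apply: lee_nneseries => [n _ _|n _]; first exact: integral_ge0.
  rewrite -[leLHS](EFin_Rint (gi n)) lee_fin RintegralZl//; last exact: ui.
  apply: (@le_trans _ _ (4 ^+ n * (c * 8^-1 ^+ n))).
    by rewrite ler_wpM2l// exprn_ge0.
  rewrite mulrCA -exprMn natrX exprS (_ : 4 * 8^-1 = 2^-1 :> R); last by field.
  rewrite exprVn invfM mulrA -[2 * c * 2^-1]mulrAC divff ?mul1r//.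
have Gfin : \forall t \ae mu, (\sum_(n <oo) g n t)%E \is a fin_num.
  have : mu.-integrable setT (fun t => (\sum_(n <oo) g n t)%E).
    apply/integrableP; split; first exact: ge0_emeasurable_sum.
    apply: le_lt_trans (ltry (2 * c)); apply: le_trans gle.
    by under eq_integral do rewrite gee0_abs ?nneseries_ge0//.
  by move=> /integrable_ae -/(_ measurableT); apply: filterS => t; exact.
apply: filterS Gfin => t /fineK Gt.
exists (fine (\sum_(n <oo) g n t)%E / W t) => n.
rewrite mulrAC ler_pdivlMr// exprVn ler_pdivlMr ?exprn_gt0// mulrC.
rewrite -lee_fin Gt; apply: le_trans (nneseries_lim_ge n.+1 _) => //.
by rewrite big_nat_recr//= leeDr// sume_ge0.
Qed.

End integration.

(** * A strictly positive element of the dual *)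

Section damping.
Variable R : realType.
Implicit Types a b s : R.

Definition damp s : R := (1 + `|s|)^-1.

Lemma damp_gt0 s : 0 < damp s.
Proof. by rewrite invr_gt0 ltr_wpDr. Qed.

Lemma damp_le1 s : damp s <= 1.
Proof. by rewrite invf_le1 ?lerDl// ltr_wpDr. Qed.

Lemma dampK s : 0 <= s -> (1 + s) * damp s = 1.
Proof. by move=> s0; rewrite /damp ger0_norm// divff// gt_eqF// ltr_wpDr. Qed.

Lemma continuous_damp : continuous damp.
Proof.
move=> s; apply: cvgV; first by rewrite gt_eqF// ltr_wpDr.
by apply: cvgD; [exact: cvg_cst|exact: cvg_norm].
Qed.

Lemma measurable_damp : measurable_fun setT damp.
Proof. exact: continuous_measurable_fun continuous_damp. Qed.

(** A quantitative strict convexity of [1 / (1 + s)]: the difference of the two sides is an explicit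
    nonnegative fraction. It makes minimising sequences Cauchy after damping. *)
Lemma damp_gap a b : 0 <= a -> 0 <= b ->
  (damp a - damp b) ^+ 2 <=
  4 * (2^-1 * damp a + 2^-1 * damp b - damp (2^-1 * a + 2^-1 * b)).
Proof.
move=> a0 b0.
have a1 : 0 < 1 + a by rewrite ltr_wpDr.
have b1 : 0 < 1 + b by rewrite ltr_wpDr.
have ab1 : 0 < 1 + (2^-1 * a + 2^-1 * b) by lra.
rewrite /damp !ger0_norm//; last by lra.
rewrite -subr_ge0.
have -> : 4 * (2^-1 / (1 + a) + 2^-1 / (1 + b) - (1 + (2^-1 * a + 2^-1 * b))^-1) -
    ((1 + a)^-1 - (1 + b)^-1) ^+ 2 =
  (a - b) ^+ 2 * (a + b + 2 * (a * b)) /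
     ((1 + a) ^+ 2 * (1 + b) ^+ 2 * (2 + a + b)).
  by field; rewrite !gt_eqF//; lra.
apply: divr_ge0; apply: mulr_ge0; rewrite ?sqr_ge0//; last by lra.
  by have := mulr_ge0 a0 b0; lra.
by apply: mulr_ge0; exact: sqr_ge0.
Qed.

Lemma damp_diff a b s : 0 <= a -> 0 <= b -> 0 <= s -> s <= 1 ->
  damp a - damp (a + s * (b - a)) =
  s * ((b - a) * damp a * damp (a + s * (b - a))).
Proof.
move=> a0 b0 s0 s1.
have z0 : 0 <= a + s * (b - a).
  have := mulr_ge0 s0 b0; have : 0 <= (1 - s) * a by apply: mulr_ge0 => //; lra.
  lra.
rewrite /damp !ger0_norm//; field.
by rewrite !gt_eqF// ltr_wpDr.
Qed.

(** The bound does not depend on [s], which lets Fatou's lemma be applied to the difference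
    quotients; [s <= 2^-1] keeps the intermediate point at least [a / 2]. *)
Lemma damp_quotient_ge a b s : 0 <= a -> 0 <= b -> 0 <= s -> s <= 2^-1 ->
  0 <= (b - a) * damp a * damp (a + s * (b - a)) + 2.
Proof.
move=> a0 b0 s0 s1.
have z1 : 2^-1 * a <= a + s * (b - a).
  have := mulr_ge0 s0 b0; have : 0 <= (2^-1 - s) * a by apply: mulr_ge0 => //; lra.
  lra.
have z0 : 0 <= a + s * (b - a) by lra.
have hz : (1 + a) * damp (a + s * (b - a)) <= 2.
  have h := dampK z0; have := damp_gt0 (a + s * (b - a)) => h0.
  have : (1 + a) * damp (a + s * (b - a)) <=
    (2 * (1 + (a + s * (b - a)))) * damp (a + s * (b - a)).
    by rewrite ler_pM2r//; lra.
  by rewrite -mulrA h mulr1.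
have ha : a * damp a <= 1.
  have := dampK a0; have := damp_gt0 a; lra.
have va := damp_gt0 a; have vz := damp_gt0 (a + s * (b - a)).
have h1 : a * damp a * damp (a + s * (b - a)) <= 2.
  apply: le_trans hz; apply: ler_pM => //; [|exact: ltW|].
    by rewrite mulr_ge0// ltW.
  lra.
have h2 : 0 <= b * damp a * damp (a + s * (b - a)).
  by rewrite !mulr_ge0// ltW.
lra.
Qed.

End damping.

Lemma cvg_ge0 (R : realType) (u : nat -> R) (l : R) :
  u n @[n --> \oo] --> l -> (forall n, 0 <= u n) -> 0 <= l.
Proof.
move=> ul u0; rewrite -(cvg_lim _ ul)//; apply: limr_ge; last exact: nearW.
by apply/cvg_ex; exists l.
Qed.

Lemma sigma_finite_weight d (T : measurableType d) (R : realType)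
    (mu : {sigma_finite_measure set T -> \bar R}) :
  exists h : T -> R, [/\ measurable_fun setT h, forall t, 0 < h t,
    forall t, h t <= 1 & integ mu h].
Proof.
have [F FT /all_and2[mF Foo]] := sigma_finiteT mu.
(* The powers of 2 keep the sum of the [c n] at most 1, and the last factor keeps the sum of the
   [c n * mu (F n)] at most 1. *)
pose c n : R := 1 / (2 ^ n.+1)%:R / (1 + fine (mu (F n))).
have m0 n : 0 <= fine (mu (F n)) by rewrite fine_ge0.
have p0 n : 0 < 1 / (2 ^ n.+1)%:R :> R by rewrite divr_gt0// ltr0n expn_gt0.
have c0 n : 0 < c n by rewrite divr_gt0// ltr_wpDr.
have cle n : c n <= 1 / (2 ^ n.+1)%:R.
  rewrite ler_pdivrMr ?ltr_wpDr// -[leLHS]mulr1; apply: ler_wpM2l; first exact: ltW.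
  by rewrite lerDl.
pose H t := (\sum_(n <oo) (c n * \1_(F n) t)%:E)%E.
have g0 n t : (0 <= (c n * \1_(F n) t)%:E)%E.
  by rewrite lee_fin mulr_ge0// ltW.
have mg n : measurable_fun setT (fun t => (c n * \1_(F n) t)%:E).
  by apply/measurable_EFinP/measurable_funM => //; exact: measurable_indic.
have H1 t : (H t <= 1)%E.
  apply: le_trans (epsilon_trick0 _ (@ler01 R)); apply: lee_nneseries => // n _.
  rewrite lee_fin; apply: le_trans (cle n).
  rewrite -[leRHS]mulr1; apply: ler_wpM2l; first exact: ltW.
  by rewrite indicE; case: (_ \in _).
have Hfin t : H t \is a fin_num.
  by rewrite ge0_fin_numE ?nneseries_ge0// (le_lt_trans (H1 t))// ltry.
have mH : measurable_fun setT H by exact: ge0_emeasurable_sum.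
have H0 t : (0 < H t)%E.
  have : setT t by []. rewrite FT => -[n _ Fnt].
  apply: (@lt_le_trans _ _ (\sum_(0 <= k < n.+1) (c k * \1_(F k) t)%:E)%E); last first.
    exact: nneseries_lim_ge.
  rewrite big_nat_recr//=; apply: (@lt_le_trans _ _ (c n * \1_(F n) t)%:E).
    by rewrite lte_fin indicE mem_set// mulr1.
  by rewrite leeDr// sume_ge0.
have mfH : measurable_fun setT (fun t => fine (H t)) by exact: measurableT_comp.
have [||hi _] := @integ_of_bound _ _ _ mu (fun t => fine (H t)) 1 mfH.
- by move=> t; rewrite fine_ge0// ltW.
- under eq_integral do rewrite fineK//.
  rewrite integral_nneseries//; apply: le_trans (epsilon_trick0 _ (@ler01 R)).
  apply: lee_nneseries => [n _ _|n _]; first exact: integral_ge0.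
  under eq_integral do rewrite EFinM.
  rewrite ge0_integralZl//; last 2 first.
  - by apply/measurable_EFinP; exact: measurable_indic.
  - by rewrite lee_fin ltW.
  rewrite integral_indic//.
  have fn : (mu (F n)) \is a fin_num by rewrite ge0_fin_numE; [exact: Foo|exact: measure_ge0].
  rewrite setIT -[X in (_ * X)%E](fineK fn) -EFinM lee_fin.
  rewrite /c -[leLHS]mulrA -[leRHS]mulr1; apply: ler_wpM2l; first exact: ltW.
  by rewrite mulrC ler_pdivrMr ?ltr_wpDr// mul1r lerDr.
exists (fun t => fine (H t)); split => //.
- by move=> t; rewrite -lte_fin fineK.
- by move=> t; rewrite -lee_fin fineK.
Qed.

Section weight.
Context d (T : measurableType d) (R : realType) (mu : {measure set T -> \bar R}).
Variable X : banachFunctionLattice mu.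
Hypothesis fat : fatou_property X.
Variable h : T -> R.
Hypotheses (mh : measurable_fun setT h) (h0 : forall t, 0 < h t)
  (h1 : forall t, h t <= 1) (hi : integ mu h).

Let P (y : X) := `|y| <= 1 /\ \forall t \ae mu, 0 <= rep y t.
Let v (y : X) t := damp (rep y t).
Let J (y : X) := \int[mu]_t (v y t * h t).
Let Ih := \int[mu]_t h t.

Let mv y : measurable_fun setT (v y).
Proof. exact: (measurableT_comp (@measurable_damp R) (@measurable_rep _ _ _ _ X y)). Qed.

Let v0 y t : 0 < v y t. Proof. exact: damp_gt0. Qed.
Let v1 y t : v y t <= 1. Proof. exact: damp_le1. Qed.

Let vhi y : integ mu (fun t => v y t * h t).
Proof.
apply: integ_le hi; first exact: measurable_funM.
move=> t; rewrite normrM ler_piMl// ger0_norm//; exact: ltW.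
Qed.

Let Pconv y z s : 0 <= s -> s <= 1 -> P y -> P z -> P (s *: y + (1 - s) *: z).
Proof.
move=> s0 s1 [y1 yp] [z1 zp].
have s1' : 0 <= 1 - s by lra.
split.
  apply: le_trans (ler_normD _ _) _; rewrite !normrZ (ger0_norm s0) (ger0_norm s1').
  have := ler_wpM2l s0 y1; have := ler_wpM2l s1' z1; lra.
move: (repD (s *: y) ((1 - s) *: z)) (repZ s y) (repZ (1 - s) z) yp zp.
apply: filterS5 => t -> -> -> y0 z0.
by apply: addr_ge0; exact: mulr_ge0.
Qed.

Let P0 : P 0.
Proof. by split; [rewrite normr0|apply: filterS (rep0 X) => t ->]. Qed.

Let J_inf : has_inf (J @` P).
Proof.
split; first by exists (J 0); exists 0.
by exists 0 => _ [y _ <-]; apply: Rintegral_ge0 => t _; rewrite mulr_ge0// ltW.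
Qed.

Let m0 := inf (J @` P).

Let J_ge y : P y -> m0 <= J y.
Proof. by move=> Py; apply: ge_inf; [exact: J_inf.2|exists y]. Qed.

(** The midpoint of [y] and [z] competes for the infimum [m0], so the convexity gap of [J] is at
    most [e], and [damp_gap] can be integrated. *)
Let J_gap y z e : P y -> P z -> J y <= m0 + e -> J z <= m0 + e ->
  integ mu (fun t => (v y t - v z t) ^+ 2 * h t) /\
  \int[mu]_t ((v y t - v z t) ^+ 2 * h t) <= 4 * e.
Proof.
move=> Py Pz Jy Jz.
pose m : X := 2^-1 *: y + (1 - 2^-1) *: z.
have Pm : P m by apply: Pconv => //; lra.
pose g t := 4 * (2^-1 * (v y t * h t) + (2^-1 * (v z t * h t) + (-1) * (v m t * h t))).
have gi : integ mu g.
  by apply: integZ; apply: integD; [exact: integZ|apply: integD; exact: integZ].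
have gE : \int[mu]_t g t = 4 * (2^-1 * J y + (2^-1 * J z + (-1) * J m)).
  rewrite /g RintegralZl//; last first.
    by apply: integD; [exact: integZ|apply: integD; exact: integZ].
  rewrite RintegralD//; [|exact: integZ|by apply: integD; exact: integZ].
  rewrite RintegralD//; [|exact: integZ|exact: integZ].
  by rewrite !(RintegralZl _ measurableT (vhi _)).
have le : \forall t \ae mu, (v y t - v z t) ^+ 2 * h t <= g t.
  move: (repD (2^-1 *: y) ((1 - 2^-1) *: z)) (repZ 2^-1 y) (repZ (1 - 2^-1) z) Py.2 Pz.2.
  apply: filterS5 => t e1 e2 e3 y0 z0.
  rewrite /g (_ : 4 * _ = 4 * (2^-1 * v y t + 2^-1 * v z t - v m t) * h t); last by ring.
  rewrite ler_pM2r//; apply: le_trans (damp_gap y0 z0) _.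
  by rewrite {3}/v e1 e2 e3 (_ : 1 - 2^-1 = 2^-1 :> R)//; field.
have si : integ mu (fun t => (v y t - v z t) ^+ 2 * h t).
  apply: integ_le_ae gi.
    apply: measurable_funM => //; apply: measurable_funX; exact: measurable_funB.
  apply: filterS le => t le; rewrite ger0_norm; last first.
    by rewrite mulr_ge0 ?sqr_ge0// ltW.
  exact: le_trans le (ler_norm _).
split => //; apply: le_trans (Rint_le_ae si gi le) _; rewrite gE.
have := J_ge Pm; lra.
Qed.

(** The rate [64^-1 ^+ n] for [J] becomes [8^-1 ^+ n] after the square root implicit in [v_fast], as
    [fast_ae] requires. *)
Let min_seq : exists y : nat -> X, forall n, P (y n) /\ J (y n) <= m0 + 64^-1 ^+ n.
Proof.
suff /choice[y yP] n : exists y, P y /\ J y <= m0 + 64^-1 ^+ n by exists y.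
have [|_ [y Py <-] /ltW yn] := @inf_adherent _ (J @` P) (64^-1 ^+ n) _ J_inf.
  by rewrite exprn_gt0.
by exists y.
Qed.

Let v_fast (y : nat -> X) : (forall n, P (y n) /\ J (y n) <= m0 + 64^-1 ^+ n) ->
  \forall t \ae mu, exists K, forall n,
    `|v (y n.+1) t - v (y n) t| <= K * 4^-1 ^+ n.
Proof.
move=> yP.
suff di n : integ mu (fun t => `|v (y n.+1) t - v (y n) t| * h t) /\
   \int[mu]_t (`|v (y n.+1) t - v (y n) t| * h t) <= (Ih + 1) * 8^-1 ^+ n.
  by apply: (@fast_ae _ _ _ mu (fun n t => v (y n.+1) t - v (y n) t) h (Ih + 1) h0) => n; have [] := di n.
have e0 : 0 < 64^-1 ^+ n :> R by rewrite exprn_gt0.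
have [|si sle] := J_gap (yP n.+1).1 (yP n).1 _ (yP n).2.
  apply: le_trans (yP n.+1).2 _; rewrite lerD2l exprS -[leRHS]mul1r.
  by apply: ler_wpM2r; [exact: ltW|lra].
pose r : R := 8^-1 ^+ n.
have r0 : 0 < r by rewrite exprn_gt0.
have rr : r ^+ 2 = 64^-1 ^+ n.
  by rewrite -exprM mulnC exprM (_ : 8^-1 ^+ 2 = 64^-1 :> R)//; field.
(* Cauchy-Schwarz is replaced by [|a| <= r + a ^+ 2 / (4 * r)] with [r = 8^-1 ^+ n]. *)
pose g t := r * h t + (4 * r)^-1 * ((v (y n.+1) t - v (y n) t) ^+ 2 * h t).
have gi : integ mu g by apply: integD; exact: integZ.
have le t : `|v (y n.+1) t - v (y n) t| * h t <= g t.
  rewrite /g mulrA -mulrDl ler_pM2r//.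
  set a := v (y n.+1) t - v (y n) t.
  rewrite -subr_ge0 -real_normK ?num_real//.
  have -> : r + (4 * r)^-1 * `|a| ^+ 2 - `|a| = (4 * r)^-1 * (`|a| - 2 * r) ^+ 2.
    by field; rewrite gt_eqF.
  by rewrite mulr_ge0 ?sqr_ge0// invr_ge0 mulr_ge0// ltW.
have ai : integ mu (fun t => `|v (y n.+1) t - v (y n) t| * h t).
  apply: integ_le gi.
    by apply: measurable_funM => //; apply: measurableT_comp => //; exact: measurable_funB.
  move=> t; rewrite ger0_norm ?mulr_ge0 ?(ltW (h0 t))//.
  exact: le_trans (le t) (ler_norm _).
split => //; apply: le_trans (Rint_le ai gi le) _.
rewrite /g RintegralD//; [|exact: integZ|exact: integZ].
rewrite !RintegralZl// -/Ih -/r.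
have : (4 * r)^-1 * \int[mu]_t ((v (y n.+1) t - v (y n) t) ^+ 2 * h t) <= (4 * r)^-1 * (4 * r ^+ 2).
  by rewrite rr ler_wpM2l// invr_ge0 mulr_ge0// ltW.
rewrite (_ : (4 * r)^-1 * (4 * r ^+ 2) = r); first lra.
by field; rewrite gt_eqF.
Qed.

(* A sequence in the positive unit ball cannot grow faster than [2^n] anywhere,
   since [sum 2^-n y_n] is an element of the space. *)
Lemma positive_ball_bounded (y : nat -> X) :
  (forall n, `|y n| <= 1 /\ \forall t \ae mu, 0 <= rep (y n) t) ->
  exists x : X, \forall t \ae mu, forall n, rep (y n) t <= 2 ^+ n * rep x t.
Proof.
move=> yP.
pose S := fix S n := if n is k.+1 then S k + 2^-1 ^+ k *: y k else 0 : X.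
have q0 n : 0 < (2^-1 : R) ^+ n by rewrite exprn_gt0.
have Sdist n k : `|S n - S (n + k)%N| <= 2 * 2^-1 ^+ n - 2 * 2^-1 ^+ (n + k).
  elim: k => [|k IH]; first by rewrite addn0 !subrr normr0.
  rewrite addnS /= opprD addrA.
  apply: le_trans (ler_normB _ _) _; rewrite normrZ gtr0_norm//.
  have h2 : 2^-1 ^+ (n + k) * `|y (n + k)%N| <= 2^-1 ^+ (n + k).
    rewrite -[leRHS]mulr1; apply: ler_wpM2l; first exact: ltW.
    exact: (yP _).1.
  rewrite exprS mulrA divff ?mul1r//.
  move: IH h2; move: (2^-1 ^+ n) (2^-1 ^+ (n + k)) => a b; lra.
have Spos n k : \forall t \ae mu, 0 <= rep (S (n + k)%N - S n) t.
  elim: k => [|k IH].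
    by rewrite addn0 subrr; apply: filterS (rep0 X) => t ->.
  rewrite addnS /= addrAC.
  move: (repD (S (n + k)%N - S n) (2^-1 ^+ (n + k) *: y (n + k)%N)).
  move: (repZ (2^-1 ^+ (n + k)) (y (n + k)%N)) (yP (n + k)%N).2 IH.
  apply: filterS4 => t e1 y0 S0 ->; rewrite e1.
  by rewrite addr_ge0// mulr_ge0// ltW.
have Sc e : 0 < e -> exists n, forall m, (n <= m)%N -> `|S n - S m| <= e.
  move=> e0; have [|n nP] := @half_expr_lt R (e / 2); first by rewrite divr_gt0.
  exists n => m /subnKC <-; apply: le_trans (Sdist _ _) _.
  move: nP (q0 n) (q0 (n + (m - n))%N).
  by move: (2^-1 ^+ n) (2^-1 ^+ (n + (m - n))) => a b; lra.
have [x xS] := cauchy_seq_limit Sc; exists x.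
have key n : \forall t \ae mu, 0 <= rep (x - 2^-1 ^+ n *: y n) t.
  apply: rep_ge0_closed => e /xS[k /(_ (n.+1 + k)%N (leq_addl _ _)) kx].
  exists (S (n.+1 + k)%N - 2^-1 ^+ n *: y n); last first.
    by rewrite opprB addrA subrK ltW.
  move: (Spos n.+1 k) (Spos 0%N n) (repD (S (n.+1 + k)%N - S n.+1) (S n)).
  rewrite add0n /= subr0; apply: filterS3 => t a0 b0 e1.
  have -> : S (n.+1 + k)%N - 2^-1 ^+ n *: y n =
     S (n.+1 + k)%N - (S n + 2^-1 ^+ n *: y n) + S n.
    by rewrite [S n + _]addrC opprD addrA subrK.
  by rewrite e1 addr_ge0.
apply: ae_foralln => n.
apply: filterS3 (key n) (repB x (2^-1 ^+ n *: y n)) (repZ (2^-1 ^+ n) (y n)).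
move=> t le e1 e2; rewrite e1 e2 subr_ge0 in le.
have := ler_wpM2l (exprn_ge0 n (ler0n R 2)) le.
by rewrite mulrA -exprMn divff// expr1n mul1r.
Qed.

(** Damped values converge at the rate [4^-1 ^+ n] while [rep (y n)] grows at most like [2 ^+ n], so
    the damped limit is not 0 and [rep (y n)] itself converges almost everywhere. *)
Let minimiser : exists a, P a /\ J a <= m0.
Proof.
have [y yP] := min_seq.
have [x xP] := @positive_ball_bounded y (fun n => (yP n).1).
have mvl := measurable_limit (fun n => measurable_rep (y n)).
have [f mf fP] := mvl.
have yf : \forall t \ae mu, rep (y n) t @[n --> \oo] --> f t.
  have ypos : \forall t \ae mu, forall n, 0 <= rep (y n) t.
    by apply: ae_foralln => n; have [[]] := yP n.
  move: (v_fast yP) xP ypos; apply: filterS3 => t [K Kn] xt yt.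
  have [l [vl lK]] := fast_cauchy_limit Kn.
  suff l0 : 0 < l.
    suff yl : rep (y n) t @[n --> \oo] --> l^-1 - 1 by rewrite (fP _ _ yl).
    have -> : (fun n => rep (y n) t) = (fun n => (v (y n) t)^-1 - 1).
      by apply/funext => n; rewrite /v /damp invrK ger0_norm// addrC addKr.
    apply: cvgB; last exact: cvg_cst.
    by apply: cvgV => //; rewrite gt_eqF.
  have lge0 : 0 <= l by apply: cvg_ge0 vl _ => n; exact: ltW.
  (* If [l = 0], then [1 = (1 + rep (y n) t) * v (y n) t] is at most
     [2 * K * (1 + |rep x t|) * 2^-1 ^+ n], absurd for large [n]. *)
  rewrite lt_neqAle lge0 andbT; apply/eqP => l0; rewrite -l0 in lK.
  have K0 : 0 <= K.
    by have := lK 0%N; rewrite subr0 expr0 mulr1; have := normr_ge0 (v (y 0%N) t); lra.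
  pose D := 2 * K * (1 + `|rep x t|) + 1.
  have D0 : 0 < D by rewrite ltr_wpDl// !mulr_ge0// addr_ge0.
  have [|n nD] := @half_expr_lt R D^-1; first by rewrite invr_gt0.
  have vn : v (y n) t <= 2 * K * 4^-1 ^+ n.
    by have := lK n; rewrite subr0 gtr0_norm.
  have e2 : (2^-1 : R) ^+ n * 2^-1 ^+ n = 4^-1 ^+ n.
    by rewrite -exprMn (_ : 2^-1 * 2^-1 = 4^-1 :> R)//; field.
  have e1 : (2 : R) ^+ n * 2^-1 ^+ n = 1 by rewrite -exprMn mulfV// expr1n.
  have q0 : 0 < (2^-1 : R) ^+ n by rewrite exprn_gt0.
  have q1 : (2^-1 : R) ^+ n <= 1 by apply: exprn_ile1 => //; lra.
  have h2 : (1 + rep (y n) t) * 2^-1 ^+ n <= 1 + `|rep x t|.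
    have h3 : rep (y n) t * 2^-1 ^+ n <= `|rep x t|.
      have := ler_wpM2r (ltW q0) (xt n).
      rewrite [leRHS]mulrAC e1 mul1r => h4.
      exact: le_trans h4 (ler_norm _).
    lra.
  have : 1 <= 2 * K * (1 + `|rep x t|) * 2^-1 ^+ n.
    have yt1 : 0 <= 1 + rep (y n) t by have := yt n; lra.
    have h5 := ler_wpM2l yt1 vn.
    rewrite dampK// -e2 in h5; apply: le_trans h5 _.
    rewrite [leLHS](_ : _ = 2 * K * 2^-1 ^+ n * ((1 + rep (y n) t) * 2^-1 ^+ n)); last by ring.
    rewrite [leRHS](_ : _ = 2 * K * 2^-1 ^+ n * (1 + `|rep x t|)); last by ring.
    by apply: ler_wpM2l => //; rewrite !mulr_ge0// ltW.
  rewrite -(ltr_pM2r D0) mulVf ?gt_eqF// in nD.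
  have : 2 * K * (1 + `|rep x t|) * 2^-1 ^+ n <= D * 2^-1 ^+ n.
    by rewrite ler_pM2r// /D lerDl.
  rewrite mulrC in nD; lra.
have [a af a1] := fatou_ae_limit fat mf (fun n => (yP n).1.1) yf.
have Pa : P a.
  split => //; have ypos : \forall t \ae mu, forall n, 0 <= rep (y n) t.
    by apply: ae_foralln => n; have [[]] := yP n.
  by move: af yf ypos; apply: filterS3 => t -> yt y0; exact: cvg_ge0 yt y0.
exists a; split => //.
apply/ler_addgt0Pr => e /half_expr_lt[N Ne].
(* [fatou_bound] wants one bound for all indices, so the sequence is started at [N], from where on
   [J] is at most [m0 + e]. *)
have [|||||_ le] := @fatou_bound _ _ _ mu (fun n t => v (y (n + N)%N) t * h t)
  (fun t => v a t * h t) (m0 + e) (fun n => vhi (y (n + N)%N)).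
- by move=> n t; rewrite mulr_ge0// ltW.
- exact: measurable_funM.
- by move=> t; rewrite mulr_ge0// ltW.
- move: af yf; apply: filterS2 => t <- yt; apply: cvgMl.
  have : v (y n) t @[n --> \oo] --> v a t.
    by apply: continuous_cvg yt; exact: continuous_damp.
  by rewrite -(cvg_shiftn N).
- move=> n; apply: le_trans (yP _).2 _; rewrite lerD2l.
  apply: le_trans (ltW Ne).
  apply: (@le_trans _ _ ((2^-1 : R) ^+ (n + N))).
    by apply: lerXn2r; rewrite ?nnegrE//; lra.
  by rewrite exprD ler_piMl ?exprn_ge0// exprn_ile1//; lra.
exact: le.
Qed.

(* First-order optimality at the minimiser [a] of [\int h / (1 + y)] gives
   [\int (b - a) h / (1 + a)^2 <= 0] for [b] in the positive unit ball. *)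
Theorem exists_dual_weight : exists w : T -> R,
  [/\ measurable_fun setT w, forall t, 0 < w t, forall t, w t <= 1, integ mu w &
    exists C, forall x : X, integ mu (fun t => `|rep x t| * w t) /\
      \int[mu]_t (`|rep x t| * w t) <= C * `|x| ].
Proof.
have [a [Pa Ja]] := minimiser.
pose w t := v a t * v a t * h t.
have mw : measurable_fun setT w by apply: measurable_funM => //; exact: measurable_funM.
have w0 t : 0 < w t by rewrite !mulr_gt0.
have vv1 t : v a t * v a t <= 1.
  by rewrite -[leRHS]mulr1; apply: ler_pM => //; exact: ltW.
have wh t : w t <= h t by rewrite ler_piMl// ltW.
exists w; split => //.
- by move=> t; exact: le_trans (wh t) (h1 t).
- by apply: integ_le hi => // t; rewrite !gtr0_norm.
exists (2 * Ih).
suff PC b : P b -> integ mu (fun t => `|rep b t| * w t) /\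
      \int[mu]_t (`|rep b t| * w t) <= 2 * Ih.
  move=> x; have [->|xn0] := eqVneq x 0.
    have z : \forall t \ae mu, `|rep (0 : X) t| * w t = 0.
      by apply: filterS (rep0 X) => t ->; rewrite normr0 mul0r.
    have [zi _] := PC _ P0; split => //.
    rewrite (ae_eq_Rint (integ_measurable zi) _ z)//.
    by rewrite Rintegral_cst// mul0r normr0 mulr0.
  have x0 : 0 < `|x| by rewrite normr_gt0.
  have [||b bx b1] := @ideal_rep _ _ _ _ X (fun t => `|x|^-1 * `|rep x t|) (`|x|^-1 *: x).
  - apply: measurable_funM => //; apply: measurableT_comp => //; exact: measurable_rep.
  - by apply: filterS (repZ `|x|^-1 x) => t ->; rewrite normrM normr_id -normrM.
  have Pb : P b.
    split; last by apply: filterS bx => t ->; rewrite mulr_ge0// invr_ge0.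
    by apply: le_trans b1 _; rewrite normrZ normfV normr_id mulVf// gt_eqF.
  have [bi bC] := PC b Pb.
  have E : \forall t \ae mu, `|rep x t| * w t = `|x| * (`|rep b t| * w t).
    apply: filterS bx => t ->; rewrite normrM normfV !normr_id !mulrA.
    by rewrite divff ?mul1r// gt_eqF.
  have mx : measurable_fun setT (fun t => `|rep x t| * w t).
    apply: measurable_funM => //; apply: measurableT_comp => //; exact: measurable_rep.
  have bi' := integZ `|x| bi.
  split.
    by apply: integ_le_ae bi' => //; apply: filterS E => t ->.
  rewrite (ae_eq_Rint mx (integ_measurable bi') E) RintegralZl// mulrC.
  by rewrite ler_pM2r.
move=> Pb.
(* The exponent [n.+1] gives [s n <= 2^-1], as [damp_quotient_ge] requires; the summand 2 in [psi]
   is the lower bound found there. *)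
pose s n : R := 2^-1 ^+ n.+1.
have s0 n : 0 < s n by rewrite exprn_gt0.
have s1 n : s n <= 2^-1.
  by rewrite /s exprS ler_piMr//; apply: exprn_ile1 => //; lra.
pose A t := `|rep a t|; pose B t := `|rep b t|.
pose psi n t := (B t - A t) * damp (A t) * damp (A t + s n * (B t - A t)) + 2.
have mA : measurable_fun setT A by apply: measurableT_comp => //; exact: measurable_rep.
have mB : measurable_fun setT B by apply: measurableT_comp => //; exact: measurable_rep.
have psi0 n t : 0 <= psi n t.
  by apply: damp_quotient_ge; rewrite ?normr_ge0 ?(ltW (s0 n)).
pose z n : X := s n *: b + (1 - s n) *: a.
have s11 n : s n <= 1 by have := s1 n; lra.
have Pz n : P (z n) by apply: Pconv => //; exact: ltW.
have ab : \forall t \ae mu, 0 <= rep a t /\ 0 <= rep b t.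
  by apply: filterS2 Pa.2 Pb.2.
have psiE n : \forall t \ae mu, psi n t * h t =
    (s n)^-1 * (v a t * h t + (-1) * (v (z n) t * h t)) + 2 * h t.
  move: (repD (s n *: b) ((1 - s n) *: a)) (repZ (s n) b) (repZ (1 - s n) a) ab.
  apply: filterS4 => t e1 e2 e3 [a0 b0].
  have zE : rep (z n) t = A t + s n * (B t - A t).
    by rewrite /z e1 e2 e3 /A /B !ger0_norm//; ring.
  have vA : v a t = damp (A t) by rewrite /v /A ger0_norm.
  have := @damp_diff _ (A t) (B t) (s n) (normr_ge0 _) (normr_ge0 _) (ltW (s0 n)) (s11 n).
  rewrite -vA -zE -/(v (z n) t) => dd.
  rewrite /psi mulrDl; congr (_ + _).
  rewrite mulN1r -mulrBl dd -vA -zE -/(v (z n) t).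
  by rewrite !mulrA mulVf ?gt_eqF// mul1r.
have psii n : integ mu (fun t => psi n t * h t).
  have gi : integ mu (fun t => (s n)^-1 * (v a t * h t + (-1) * (v (z n) t * h t)) + 2 * h t).
    by apply: integD; apply: integZ => //; apply: integD => //; exact: integZ.
  apply: integ_le_ae gi; last by apply: filterS (psiE n) => t ->.
  apply: measurable_funM => //; apply: measurable_funD => //.
  have mBA : measurable_fun setT (fun t => B t - A t) by exact: measurable_funB.
  apply: measurable_funM; last first.
    apply: (measurableT_comp (@measurable_damp R)); apply: measurable_funD => //.
    exact: measurable_funM.
  apply: measurable_funM => //; exact: (measurableT_comp (@measurable_damp R)).
(* Minimality of [a] makes the integral of the difference quotient nonpositive; only that of [2 * h]
   remains. *)
have psiI n : \int[mu]_t (psi n t * h t) <= 2 * Ih.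
  have i1 : integ mu (fun t => v a t * h t + (-1) * (v (z n) t * h t)).
    by apply: integD => //; exact: integZ.
  have i2 := integZ 2 hi.
  have i3 := integZ (s n)^-1 i1.
  rewrite (ae_eq_Rint (integ_measurable (psii n)) (integ_measurable (integD i3 i2)) (psiE n)).
  rewrite RintegralD// !RintegralZl// RintegralD//; [|exact: vhi|exact: integZ].
  rewrite (RintegralZl _ measurableT (vhi _)) -/(J a) -/(J (z n)) -/Ih gerDr.
  rewrite mulr_ge0_le0 ?invr_ge0 ?(ltW (s0 n))//.
  by have := J_ge (Pz n); lra.
pose g t := (B t - A t) * damp (A t) * damp (A t) + 2.
have BA t : 0 <= B t * damp (A t) * damp (A t) <= g t.
  have d0 := damp_gt0 (A t).
  have Bd : 0 <= B t * damp (A t) * damp (A t).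
    by rewrite !mulr_ge0// ?(ltW d0)// normr_ge0.
  apply/andP; split => //.
  have k := @dampK _ (A t) (normr_ge0 _).
  have Ad : A t * damp (A t) <= 1 by lra.
  have : A t * damp (A t) * damp (A t) <= 1 * 1.
    by apply: ler_pM => //; rewrite ?mulr_ge0 ?damp_le1// ?normr_ge0 ?(ltW d0).
  rewrite /g; lra.
have g0 t : 0 <= g t by have /andP[] := BA t; exact: le_trans.
have mg : measurable_fun setT (fun t => g t * h t).
  apply: measurable_funM => //; apply: measurable_funD => //.
  have mBA : measurable_fun setT (fun t => B t - A t) by exact: measurable_funB.
  have mdA : measurable_fun setT (fun t => damp (A t)).
    exact: (measurableT_comp (@measurable_damp R)).
  by apply: measurable_funM => //; exact: measurable_funM.
have [|||||gi gI] := @fatou_bound _ _ _ mu (fun n t => psi n t * h t)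
  (fun t => g t * h t) (2 * Ih) psii.
- by move=> n t; rewrite mulr_ge0// ltW.
- exact: mg.
- by move=> t; rewrite mulr_ge0// ltW.
- apply: nearW => t; apply: cvgMr_tmp; apply: cvgD; last exact: cvg_cst.
  apply: cvgMl_tmp; apply: continuous_cvg; first exact: continuous_damp.
  rewrite -[X in _ --> X]addr0; apply: cvgD; first exact: cvg_cst.
  rewrite -[X in _ --> X](mul0r (B t - A t)); apply: cvgMr_tmp.
  have half1 : `|2^-1 : R| < 1 by rewrite ger0_norm//; lra.
  have := cvg_expr half1; rewrite -(cvg_shiftn 1).
  by under eq_fun do rewrite /= addn1.
- exact: psiI.
have mbw : measurable_fun setT (fun t => `|rep b t| * w t) by exact: measurable_funM.
have ble : \forall t \ae mu, `|rep b t| * w t <= g t * h t.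
  apply: filterS Pa.2 => t a0; rewrite /w mulrA ler_pM2r// mulrA.
  by have /andP[_] := BA t; rewrite /A ger0_norm.
have bi : integ mu (fun t => `|rep b t| * w t).
  apply: integ_le_ae gi => //; apply: filterS ble => t le.
  by rewrite ger0_norm ?(le_trans le) ?ler_norm// mulr_ge0// ltW.
split => //; exact: le_trans (Rint_le_ae bi gi ble) gI.
Qed.

End weight.

(** * Uniform integrability and uniform convexity *)

Section clipping.
Variable R : realType.
Implicit Types N c s x y : R.

Definition clip N s : R := Num.max (- N) (Num.min s N).

Definition excess N s : R := Num.max (`|s| - N) 0.

(* The largest convex function below [s ^+ 2] with slope at most [2 * N]. *)
Definition huber N s : R := 2 * clip N s * s - clip N s ^+ 2.

Lemma clipP N s : 0 <= N ->
  [\/ s < - N /\ clip N s = - N, - N <= s <= N /\ clip N s = s |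
      N < s /\ clip N s = N].
Proof.
move=> N0; rewrite /clip; case: (leP s N) => sN.
  case: (leP (- N) s) => Ns; first by constructor 2.
  by constructor 1.
by constructor 3; split => //; apply/max_idPr; lra.
Qed.

Lemma clip_le N s : 0 <= N -> - N <= clip N s <= N.
Proof. by move=> N0; case: (clipP s N0) => -[h ->]; lra. Qed.

Lemma clip_norm_le N s : 0 <= N -> `|clip N s| <= N.
Proof. by move=> N0; rewrite ler_norml clip_le. Qed.

Lemma clip_id N s : `|s| <= N -> clip N s = s.
Proof.
move=> sN; have N0 : 0 <= N := le_trans (normr_ge0 _) sN.
by move: sN; rewrite ler_norml => /andP[h1 h2]; case: (clipP s N0) => -[h ->]; lra.
Qed.

Lemma sub_clip_excess N s : 0 <= N -> `|s - clip N s| = excess N s.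
Proof.
move=> N0; rewrite /excess; case: (clipP s N0) => -[h ->].
- rewrite !ltr0_norm; [|lra|lra]; apply/esym; rewrite max_l; lra.
- rewrite subrr normr0; apply/esym/max_idPr.
  by rewrite subr_le0 ler_norml.
- rewrite !gtr0_norm; [|lra|lra]; apply/esym; rewrite max_l; lra.
Qed.

Lemma excess_ge0 N s : 0 <= excess N s.
Proof. by rewrite le_max lexx orbT. Qed.

Lemma excess_le N s : 0 <= N -> excess N s <= `|s|.
Proof. by move=> N0; rewrite ge_max normr_ge0 andbT gerBl. Qed.

Lemma clip_dist N x y : 0 <= N -> `|clip N x - clip N y| <= `|x - y|.
Proof.
move=> N0; case: (clipP x N0) => -[hx ->]; case: (clipP y N0) => -[hy ->];
  rewrite ler_norml; have := ler_norm (x - y); have := ler_norm (y - x);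
  rewrite (distrC y x) => h1 h2; apply/andP; split; lra.
Qed.

(** [huber N s] is the maximum of [2 * c * s - c ^+ 2] over [|c| <= N], attained at [clip N s]. As
    this is quadratic in [c] with leading coefficient -1, it falls off from the maximum at least by
    the squared distance to the maximiser. *)
Lemma huber_ge N c s : 0 <= N -> - N <= c <= N ->
  2 * c * s - c ^+ 2 + (clip N s - c) ^+ 2 <= huber N s.
Proof.
move=> N0 /andP[c1 c2]; rewrite /huber -subr_ge0.
have -> : 2 * clip N s * s - clip N s ^+ 2 -
   (2 * c * s - c ^+ 2 + (clip N s - c) ^+ 2) =
   2 * ((clip N s - c) * (s - clip N s)) by ring.
apply: mulr_ge0 => //; case: (clipP s N0) => -[h ->].
- by rewrite -mulrNN mulr_ge0//; lra.
- by rewrite subrr mulr0.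
- by rewrite mulr_ge0//; lra.
Qed.

Lemma huber_ge_affine N c s : 0 <= N -> - N <= c <= N ->
  2 * c * s - c ^+ 2 <= huber N s.
Proof.
move=> N0 cN; apply: le_trans (huber_ge s N0 cN).
by rewrite lerDl sqr_ge0.
Qed.

Lemma huber_convex N x y t : 0 <= N -> 0 <= t -> t <= 1 ->
  huber N (t * x + (1 - t) * y) <= t * huber N x + (1 - t) * huber N y.
Proof.
move=> N0 t0 t1; rewrite {1}/huber; set c := clip _ _.
have cN : - N <= c <= N by exact: clip_le.
have t1' : 0 <= 1 - t by lra.
have hx := ler_wpM2l t0 (huber_ge_affine x N0 cN).
have hy := ler_wpM2l t1' (huber_ge_affine y N0 cN).
apply: le_trans (lerD hx hy).
by rewrite le_eqVlt; apply/orP; left; apply/eqP; ring.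
Qed.

Lemma huber_lipschitz N x y : 0 <= N ->
  huber N x - huber N y <= 2 * N * `|x - y|.
Proof.
move=> N0; have hy := huber_ge_affine y N0 (clip_le x N0).
have h : clip N x * (x - y) <= N * `|x - y|.
  apply: le_trans (ler_norm _) _; rewrite normrM ler_wpM2r//.
  exact: clip_norm_le.
apply: le_trans (lerB (lexx _) hy) _; rewrite /huber.
rewrite [leLHS](_ : _ = 2 * (clip N x * (x - y))); last by ring.
by rewrite -mulrA ler_pM2l.
Qed.

Lemma huber0 N : 0 <= N -> huber N 0 = 0.
Proof. by move=> N0; rewrite /huber clip_id ?normr0// mulr0 expr0n subrr. Qed.

Lemma huber_norm_le N s : 0 <= N -> `|huber N s| <= 2 * N * `|s|.
Proof.
move=> N0; have h1 := huber_lipschitz s 0 N0; have h2 := huber_lipschitz 0 s N0.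
by rewrite ler_norml; move: h1 h2; rewrite huber0// !subr0 !sub0r normrN; lra.
Qed.

Lemma huber_gap N x y e : 0 <= N -> 0 < e ->
  `|x - y| <= e + e^-1 * (2^-1 * huber N x + (1 - 2^-1) * huber N y
                          - huber N (2^-1 * x + (1 - 2^-1) * y))
                + (excess N x + excess N y).
Proof.
move=> N0 e0.
set g := 2^-1 * _ + _ - _.
(* Both ends are compared with the affine minorant that touches [huber N] at the midpoint. *)
have gap : (clip N x - clip N y) ^+ 2 <= 4 * g.
  rewrite /g {3}/huber; set m := 2^-1 * x + _; set c := clip N m.
  have hx := huber_ge x N0 (clip_le m N0); have hy := huber_ge y N0 (clip_le m N0).
  rewrite -/c in hx hy.
  have sq : 0 <= ((clip N x - c) + (clip N y - c)) ^+ 2 by exact: sqr_ge0.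
  have e1 : (clip N x - clip N y) ^+ 2 = 2 * (clip N x - c) ^+ 2
    + 2 * (clip N y - c) ^+ 2 - ((clip N x - c) + (clip N y - c)) ^+ 2 by ring.
  have e2 : 2 * c * m - c ^+ 2 =
     2^-1 * (2 * c * x - c ^+ 2) + 2^-1 * (2 * c * y - c ^+ 2).
    by rewrite /m; field.
  rewrite e1 e2.
  have -> : 1 - 2^-1 = 2^-1 :> R by field.
  move: hx hy sq.
  move: (2 * c * x - c ^+ 2) (2 * c * y - c ^+ 2) ((clip N x - c) ^+ 2)
    ((clip N y - c) ^+ 2) ((clip N x - c + (clip N y - c)) ^+ 2).
  by move=> p1 p2 p3 p4 p5; lra.
have h1 : `|clip N x - clip N y| <= e + e^-1 * g.
  set a := clip N x - clip N y in gap *.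
  have : e^-1 * (`|a| ^+ 2) <= e^-1 * (4 * g).
    by rewrite ler_pM2l ?invr_gt0// real_normK ?num_real.
  have : 0 <= e^-1 * (`|a| - 2 * e) ^+ 2.
    by rewrite mulr_ge0 ?sqr_ge0// invr_ge0 ltW.
  have -> : e^-1 * (`|a| - 2 * e) ^+ 2 = e^-1 * `|a| ^+ 2 - 4 * `|a| + 4 * e.
    by field; rewrite gt_eqF.
  rewrite mulrCA; lra.
have hx := sub_clip_excess x N0; have hy := sub_clip_excess y N0.
have := ler_distD (clip N x) x y; have := ler_distD (clip N y) (clip N x) y.
rewrite (distrC (clip N y) y) hx hy; lra.
Qed.

Lemma measurable_excess N : measurable_fun setT (excess N).
Proof.
apply: measurable_maxr => //; exact: measurable_funB.
Qed.

Lemma measurable_clip d (T : measurableType d) (N s : T -> R) :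
  measurable_fun setT N -> measurable_fun setT s ->
  measurable_fun setT (fun t => clip (N t) (s t)).
Proof.
move=> mN ms; apply: measurable_maxr; last exact: measurable_minr.
exact: measurableT_comp.
Qed.

Lemma measurable_huber N : measurable_fun setT (huber N).
Proof.
have mc : measurable_fun setT (clip N) by exact: measurable_clip.
apply: measurable_funB; last exact: measurable_funX.
by apply: measurable_funM => //; exact: measurable_funM.
Qed.

End clipping.

Section dual.
Context d (T : measurableType d) (R : realType) (mu : {measure set T -> \bar R}).
Variable X : banachFunctionLattice mu.
Variables (w : T -> R) (C : R).
Hypotheses (mw : measurable_fun setT w) (w0 : forall t, 0 < w t)
  (w1 : forall t, w t <= 1) (wi : integ mu w)
  (wC : forall x : X, integ mu (fun t => `|rep x t| * w t) /\
     \int[mu]_t (`|rep x t| * w t) <= C * `|x|).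

Let wC' (x : X) M : `|x| <= M -> \int[mu]_t (`|rep x t| * w t) <= `|C| * M.
Proof.
move=> xM; apply: le_trans (wC x).2 _.
apply: (@le_trans _ _ (`|C| * `|x|)); first by rewrite ler_wpM2r// ler_norm.
exact: ler_wpM2l.
Qed.

Let mrep (x : X) : measurable_fun setT (fun t => `|rep x t|).
Proof. by apply: measurableT_comp => //; exact: measurable_rep. Qed.

(* The sets [w >= e] are the sets on which the hypothesis on the dual is
   exploited: their indicators are simple elements of the dual. *)
Let E e := [set t | e <= w t].

Let mE e : measurable (E e).
Proof.
rewrite [E e](_ : _ = setT `&` w @^-1` `[e, +oo[%classic); first exact: mw.
by apply/seteqP; split => t /=; rewrite in_itv/= andbT // => -[].
Qed.

Let indE e t : 0 < e -> (\1_(E e) t : R) <= e^-1 * w t.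
Proof.
move=> e0; rewrite indicE; case: (boolP (t \in E e)) => [/set_mem h|_].
  by rewrite mulrC ler_pdivlMr// mul1r.
by rewrite mulr_ge0 ?invr_ge0// ltW.
Qed.

Let ind_ge0 (A : set T) t : 0 <= (\1_A t : R).
Proof. by rewrite indicE; case: (_ \in _). Qed.

Let muE e : 0 < e -> (mu (E e) < +oo)%E.
Proof.
move=> e0; rewrite -(setIT (E e)) -integral_indic//.
have i1 := integZ e^-1 wi.
apply: (@le_lt_trans _ _ (\int[mu]_t (e^-1 * w t)%:E)%E); last first.
  by rewrite -EFin_Rint// ltry.
apply: ge0_le_integral => //.
- by apply/measurable_EFinP; exact: measurable_indic.
- by apply/measurable_EFinP; exact: integ_measurable i1.
- by move=> t _; rewrite lee_fin; exact: indE.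
Qed.

Let kothe_ge (f : L0 mu) (y : X) : `|y| <= 1 ->
  (\int[mu]_t `|f t * rep y t|%:E <= kothe_norm X f)%E.
Proof. by move=> y1; apply: ereal_sup_ubound; exists y. Qed.

(** As [1_E <= w / e], the indicator lies in the Koethe dual, and being simple it approximates
    itself. *)
Let indicator_order_continuous e (F : L0 mu) : 0 < e ->
  order_continuous_part (kothe_norm X) = simple_closure (kothe_norm X) ->
  (\forall t \ae mu, F t = \1_(E e) t) ->
  order_continuous_part (kothe_norm X) F.
Proof.
move=> e0 -> FE.
have Ffin : (kothe_norm X F < +oo)%E.
  apply: (@le_lt_trans _ _ (e^-1 * (`|C| * 1))%:E); last exact: ltry.
  apply: ge_ereal_sup => _ [y /= y1 <-].
  have i1 := integZ e^-1 (wC y).1.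
  apply: (@le_trans _ _ (\int[mu]_t (e^-1 * (`|rep y t| * w t))%:E)%E).
    apply: ae_ge0_le_integral => //.
    - apply/measurable_EFinP; apply: measurableT_comp => //; apply: measurable_funM.
        exact: measurable_L0.
      exact: measurable_rep.
    - by move=> t _; rewrite lee_fin !mulr_ge0// ?invr_ge0// ltW.
    - by apply/measurable_EFinP; exact: integ_measurable i1.
    - apply: filterS FE => t -> _; rewrite lee_fin normrM (ger0_norm (ind_ge0 _ _)).
      by rewrite mulrCA mulrC ler_wpM2l// indE.
  rewrite -EFin_Rint// lee_fin RintegralZl//; last exact: (wC y).1.
  by rewrite ler_wpM2l ?invr_ge0 ?(ltW e0)// wC'.
split => // r r0; exists F; split => //.
  pose s : {mfun T >-> R} := indic_mfun (E e) (mE e).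
  have sE t : s t = \1_(E e) t by [].
  exists s; split.
  - apply: (@sub_finite_set _ _ [set 0; 1]) => [_ [t _ <-]|]; last exact: finite_set2.
    by rewrite sE indicE; case: (_ \in _); [right|left].
  - rewrite [X in mu X](_ : _ = E e); first exact: muE.
    apply/seteqP; split => t /=; rewrite sE indicE.
      by case: (boolP (t \in E e)) => [/set_mem//|_]; rewrite eqxx.
    by move=> h; rewrite mem_set// oner_eq0.
  - by apply: filterS FE => t ->.
rewrite subrr; apply: (@le_lt_trans _ _ 0%E); last by rewrite lte_fin.
apply: ge_ereal_sup => _ [y /= y1 <-].
rewrite (@ge0_ae_eq_integral _ _ _ _ _ _ (cst 0%E))//.
- by rewrite integral0.
- apply/measurable_EFinP; apply: measurableT_comp => //; apply: measurable_funM.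
    exact: measurable_L0.
  exact: measurable_rep.
- by apply: filterS (L0_zeroE mu) => t h _; rewrite h mul0r normr0.
Qed.

Lemma integ_excess N (x : X) : 0 <= N ->
  integ mu (fun t => excess N (rep x t) * w t ^+ 2).
Proof.
move=> N0; apply: integ_le (wC x).1.
  apply: measurable_funM; last exact: measurable_funX.
  exact: (measurableT_comp (measurable_excess _) (measurable_rep _)).
move=> t; have e0 := excess_ge0 N (rep x t); have w20 := sqr_ge0 (w t).
rewrite (ger0_norm (mulr_ge0 e0 w20)).
rewrite (ger0_norm (mulr_ge0 (normr_ge0 (rep x t)) (ltW (w0 t)))).
apply: ler_pM => //; first exact: excess_le.
by rewrite expr2 ler_piMr// ltW.
Qed.

(* Otherwise the sets where [|y n| > 2 ^ n] would carry order-continuous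
   indicators of the dual decreasing to 0 that do not become small on [y n]. *)
Theorem dual_uniform_integrability (M del : R) : 0 < del ->
  order_continuous_part (kothe_norm X) = simple_closure (kothe_norm X) ->
  exists2 N, 0 <= N & forall x : X, `|x| <= M ->
    \int[mu]_t (excess N (rep x t) * w t ^+ 2) <= del.
Proof.
move=> del0 hyp; apply: contrapT => nUI.
have bad N : 0 <= N -> exists2 x : X, `|x| <= M &
    del < \int[mu]_t (excess N (rep x t) * w t ^+ 2).
  move=> N0; apply: contrapT => h; apply: nUI; exists N => // x xM.
  by rewrite leNgt; apply/negP => h'; apply: h; exists x.
have /choice[y yP] n : exists x : X, `|x| <= M /\
    del < \int[mu]_t (excess (2 ^+ n) (rep x t) * w t ^+ 2).
  by have [|x] := bad (2 ^+ n); [exact: exprn_ge0|exists x].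
have M0 : 0 <= M := le_trans (normr_ge0 _) (yP 0%N).1.
(* With this [e] the set [w < e] contributes at most [e * (|C| * M) <= del / 2], thanks to the
   second factor [w]. *)
pose e := del / 2 / (`|C| * M + 1).
have CM0 : 0 <= `|C| * M by exact: mulr_ge0.
have e0 : 0 < e by rewrite !divr_gt0// ltr_wpDl.
pose A n := E e `&` [set t | 2 ^+ n < `|rep (y n) t|].
have mA n : measurable (A n).
  apply: measurableI; first exact: mE.
  rewrite [X in measurable X](_ : _ = setT `&` (fun t => `|rep (y n) t|) @^-1` `]2 ^+ n, +oo[%classic).
    exact: mrep.
  by apply/seteqP; split => t /=; rewrite in_itv/= andbT // => -[].
(* Markov's inequality, as [2 ^+ n * e <= |y n| * w] on [A n]. These bounds are summable, so by
   Borel-Cantelli the tail unions [B n] decrease to a null set. *)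
have muA n : (mu (A n) <= ((2 * (e^-1 * (`|C| * M))) / (2 ^ n.+1)%:R)%:E)%E.
  have i1 := integZ (e^-1 * 2^-1 ^+ n) (wC (y n)).1.
  rewrite -(setIT (A n)) -integral_indic//.
  apply: (@le_trans _ _ (\int[mu]_t (e^-1 * 2^-1 ^+ n * (`|rep (y n) t| * w t))%:E)%E).
    apply: ge0_le_integral => //.
    - by apply/measurable_EFinP; exact: measurable_indic.
    - by apply/measurable_EFinP; exact: integ_measurable i1.
    - move=> t _; rewrite lee_fin indicE; case: (boolP (t \in A n)) => [/set_mem[]|_]; last first.
        by rewrite !mulr_ge0// ?invr_ge0 ?exprn_ge0// ltW.
      rewrite /E /= => h1 h2.
      rewrite [leLHS](_ : _ = e^-1 * 2^-1 ^+ n * (2 ^+ n * e)); last first.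
        rewrite -mulrA (mulrA (2^-1 ^+ n)) -exprMn mulVf// expr1n mul1r.
        by rewrite mulVf// gt_eqF.
      rewrite ler_pM2l ?mulr_gt0 ?invr_gt0 ?exprn_gt0//.
      by apply: ler_pM; [exact: exprn_ge0|exact: ltW|exact: ltW|exact: h1].
  rewrite -EFin_Rint// lee_fin RintegralZl//; last exact: (wC _).1.
  apply: (@le_trans _ _ (e^-1 * 2^-1 ^+ n * (`|C| * M))).
    rewrite ler_wpM2l//; last exact: wC' (yP n).1.
    by rewrite mulr_ge0// ?invr_ge0 ?exprn_ge0// ltW.
  rewrite natrX exprS exprVn; rewrite le_eqVlt; apply/orP; left; apply/eqP.
  have : 2 ^+ n != 0 :> R by rewrite expf_neq0.
  by move: (2 ^+ n) => p pn; field; rewrite pn gt_eqF.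
pose B n := \bigcup_(j in [set j | (n <= j)%N]) A j.
have mB n : measurable (B n) by apply: bigcup_measurable => k _; exact: mA.
have limsup0 : mu (lim_sup_set A) = 0%E.
  apply: lim_sup_set_cvg0 => //.
  apply: (@le_lt_trans _ _ (2 * (e^-1 * (`|C| * M)))%:E); last exact: ltry.
  apply: le_trans (epsilon_trick0 xpredT _); last first.
    by rewrite !mulr_ge0// invr_ge0 ltW.
  by apply: lee_nneseries => // n _; exact: measure_ge0.
have [F FE] : exists F : L0 mu, \forall t \ae mu, F t = \1_(E e) t.
  by apply: L0_of; exact: measurable_indic.
have /choice[G GB] n : exists G : L0 mu, \forall t \ae mu, G t = \1_(B n) t.
  by apply: L0_of; exact: measurable_indic.
have BE n : B n `<=` E e by move=> t [k _ []].
have [_ /(_ G)[||_ Gcvg]] := indicator_order_continuous e0 hyp FE.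
- move=> n; apply: filterS2 FE (GB n) => t -> ->; rewrite ind_ge0 /=.
  rewrite (ger0_norm (ind_ge0 _ _)) !indicE ler_nat.
  by case: (boolP (t \in B n)) => // /set_mem/BE h; rewrite mem_set.
- have nls : \forall t \ae mu, ~ lim_sup_set A t.
    exists (lim_sup_set A); split => //; last by move=> t /= /contrapT.
    by apply: bigcap_measurable => // n _; exact: mB.
  move: (ae_foralln GB) nls; apply: filterS2 => t Gt nls.
  have Bmono n m : (n <= m)%N -> B m t -> B n t.
    by move=> nm [k /= mk Ak]; exists k => //=; exact: leq_trans mk.
  split.
    move=> n m nm; rewrite !Gt !indicE ler_nat.
    by case: (boolP (t \in B m)) => // /set_mem/(Bmono _ _ nm) h; rewrite mem_set.
  have [n nB] : exists n, ~ B n t.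
    by apply: contrapT => h; apply: nls => n _; apply: contrapT => h'; apply: h; exists n.
  apply/cvgrPdist_lt => r r0; exists n => // m /= nm.
  rewrite Gt indicE memNset ?subrr ?normr0//.
  by move=> /(Bmono _ _ nm).
(* The half of [del] that is not lost on [w < e] sits on [B n]; scaled into the unit ball, [y n]
   detects it in the dual norm of the indicator. *)
pose M' := M + 1.
have M'0 : 0 < M' by rewrite ltr_wpDl.
have big n : ((M'^-1 * (del / 2))%:E <= kothe_norm X (G n))%E.
  pose z : X := M'^-1 *: y n.
  have z1 : `|z| <= 1.
    rewrite normrZ gtr0_norm ?invr_gt0// mulrC ler_pdivrMr// mul1r.
    by apply: le_trans (yP n).1 _; rewrite lerDl.
  apply: le_trans (kothe_ge (G n) z1).
  have i0 : integ mu (fun t => \1_(B n) t * `|rep (y n) t|).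
    apply: integ_le (integZ e^-1 (wC (y n)).1).
      by apply: measurable_funM => //; exact: measurable_indic.
    move=> t; rewrite !normrM !normr_id (ger0_norm (ind_ge0 _ _)).
    rewrite mulrCA mulrC ler_wpM2l// gtr0_norm ?invr_gt0// gtr0_norm//.
    apply: le_trans (indE t e0); rewrite !indicE ler_nat.
    by case: (boolP (t \in B n)) => // /set_mem/BE h; rewrite mem_set.
  rewrite (@ge0_ae_eq_integral _ _ _ _ _ _ (fun t => (M'^-1 * (\1_(B n) t * `|rep (y n) t|))%:E))//.
  - have i1 := integZ M'^-1 i0.
    rewrite -EFin_Rint// lee_fin RintegralZl// ler_pM2l ?invr_gt0//.
    have i2 := integZ e (wC (y n)).1.
    have i3 := integD i0 i2.
    have ie : integ mu (fun t => excess (2 ^+ n) (rep (y n) t) * w t ^+ 2).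
      by apply: integ_excess; exact: exprn_ge0.
    have le : \int[mu]_t (excess (2 ^+ n) (rep (y n) t) * w t ^+ 2) <=
      \int[mu]_t (\1_(B n) t * `|rep (y n) t| + e * (`|rep (y n) t| * w t)).
      apply: Rint_le => // t.
      have n0 : 0 <= 2 ^+ n :> R by exact: exprn_ge0.
      have p1 : 0 <= \1_(B n) t * `|rep (y n) t| by rewrite mulr_ge0.
      have p2 : 0 <= e * (`|rep (y n) t| * w t).
        by apply: mulr_ge0; [exact: ltW|apply: mulr_ge0 => //; exact: ltW].
      have w2 : 0 <= w t ^+ 2 by exact: sqr_ge0.
      have [we|ew] := ltP (w t) e.
        apply: (@le_trans _ _ (e * (`|rep (y n) t| * w t))); last by rewrite lerDr.
        rewrite [leRHS]mulrCA; apply: ler_pM => //; rewrite ?excess_ge0 ?excess_le//.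
        by rewrite expr2 ler_wpM2r// ltW.
      have [yn|yn] := leP `|rep (y n) t| (2 ^+ n).
        rewrite /excess max_r ?subr_le0// mul0r; lra.
      rewrite indicE mem_set ?mul1r; last by exists n => //=.
      apply: (@le_trans _ _ (`|rep (y n) t| * 1)); last by rewrite mulr1 lerDl.
      apply: ler_pM => //; rewrite ?excess_ge0 ?excess_le//.
      by apply: exprn_ile1 => //; exact: ltW.
    rewrite RintegralD// RintegralZl// in le; last exact: (wC _).1.
    have le2 : e * \int[mu]_t (`|rep (y n) t| * w t) <= del / 2.
      apply: (@le_trans _ _ (e * (`|C| * M))); first by rewrite ler_pM2l// wC' ?(yP n).1.
      rewrite /e -mulrA -[leRHS]mulr1; apply: ler_wpM2l.
        by apply: divr_ge0; [exact: ltW|].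
      by rewrite mulrC ler_pdivrMr ?ltr_wpDl// mul1r lerDl.
    have := (yP n).2; lra.
  - apply/measurable_EFinP; apply: measurableT_comp => //; apply: measurable_funM.
      exact: measurable_L0.
    exact: measurable_rep.
  - apply/measurable_EFinP; apply: measurable_funM => //; apply: measurable_funM => //.
  - by move=> t _; rewrite lee_fin !mulr_ge0// invr_ge0 ltW.
  - apply: filterS2 (GB n) (repZ M'^-1 (y n)) => t -> -> _.
    by rewrite !normrM (ger0_norm (ind_ge0 _ _)) (@gtr0_norm _ M'^-1) ?invr_gt0// mulrCA.
have : ((M'^-1 * (del / 2))%:E <= 0)%E.
  rewrite -(cvg_lim _ Gcvg)//; apply: lime_ge; last exact: nearW.
  by apply/cvg_ex; exists 0%E.
rewrite lee_fin leNgt => /negP; apply.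
by rewrite mulr_gt0 ?invr_gt0// divr_gt0.
Qed.

End dual.

(** * Norm separability from order continuity *)

Section lattice_separability.
Context d (T : measurableType d) (R : realType) (mu : {measure set T -> \bar R}).
Variable X : banachFunctionLattice mu.
Hypothesis oc : order_continuous X.

(* Truncating at multiples of [sum_(i < N) |a i|] turns a.e. limits of the
   countable family [a] into norm limits of countably many elements. *)
Lemma ae_limits_separable (a : nat -> X) : exists e : nat -> X,
  forall (x : X) (k : nat -> nat),
    (\forall t \ae mu, rep (a (k n)) t @[n --> \oo] --> rep x t) ->
    forall eps, 0 < eps -> exists n, `|x - e n| < eps.
Proof.
have mrep (x : X) : measurable_fun setT (rep x) by exact: measurable_rep.
have /choice[b bP] i : exists b : X, \forall t \ae mu, rep b t = `|rep (a i) t|.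
  have [||b bE _] := @ideal_rep _ _ _ _ X (fun t => `|rep (a i) t|) (a i).
  - exact: measurableT_comp.
  - by apply: nearW => t; rewrite normr_id.
  by exists b.
pose S := fix S n := if n is m.+1 then S m + b m else 0 : X.
have SP : \forall t \ae mu, forall n, 0 <= rep (S n) t /\
    forall i, (i < n)%N -> `|rep (a i) t| <= rep (S n) t.
  have SD : \forall t \ae mu, forall n, rep (S n.+1) t = rep (S n) t + rep (b n) t.
    by apply: ae_foralln => n; exact: repD.
  move: (ae_foralln bP) SD (rep0 X); apply: filterS3 => t bt SD S0.
  elim=> [|n [IH0 IH]]; first by rewrite [rep _ _]S0.
  rewrite SD bt; split; first exact: addr_ge0.
  move=> i; rewrite ltnS leq_eqVlt => /orP[/eqP ->|/IH h]; first by rewrite lerDr.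
  by rewrite ler_wpDr.
(* The factor [N] makes [V N] unbounded wherever some [a i] is nonzero, so truncation at [V N] is
   eventually exact there; elsewhere the limit [x] vanishes. *)
pose V N := N%:R *: S N.
have VP : \forall t \ae mu, forall N, 0 <= rep (V N) t /\
    forall i, (i < N)%N -> N%:R * `|rep (a i) t| <= rep (V N) t.
  have VZ : \forall t \ae mu, forall N, rep (V N) t = N%:R * rep (S N) t.
    by apply: ae_foralln => N; exact: repZ.
  move: SP VZ; apply: filterS2 => t St Vt N; rewrite Vt.
  have [h1 h2] := St N; split; first exact: mulr_ge0.
  by move=> i /h2 h; exact: ler_wpM2l.
have V0 N : \forall t \ae mu, 0 <= rep (V N) t by apply: filterS VP => t /(_ N)[].
have /choice[tr trP] (Nx : nat * X) : exists y : X,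
    \forall t \ae mu, rep y t = clip (rep (V Nx.1) t) (rep Nx.2 t).
  have [||y yE _] := @ideal_rep _ _ _ _ X
    (fun t => clip (rep (V Nx.1) t) (rep Nx.2 t)) (V Nx.1).
  - exact: measurable_clip.
  - apply: filterS (V0 Nx.1) => t h; rewrite (ger0_norm h); exact: clip_norm_le.
  by exists y.
exists (fun n => if unpickle n is Some p then tr (p.1, a p.2) else 0).
move=> x k kx eps eps0.
have eps20 : 0 < eps / 2 by rewrite divr_gt0.
have [N /(_ N (leqnn N)) xN] : exists n, forall m, (n <= m)%N -> `|x - tr (m, x)| < eps / 2.
  apply: (@order_continuous_dominated _ _ _ _ X (fun m => x - tr (m, x)) x) => //.
    move=> n; move: (repB x (tr (n, x))) (trP (n, x)) (V0 n).
    apply: filterS3 => t -> -> h /=; rewrite sub_clip_excess//; exact: excess_le.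
  have trB : \forall t \ae mu, forall n,
      rep (x - tr (n, x)) t = rep x t - clip (rep (V n) t) (rep x t).
    apply: ae_foralln => n; apply: filterS2 (repB x (tr (n, x))) (trP (n, x)).
    by move=> t -> ->.
  move: trB VP kx; apply: filterS3 => t trt Vt kt.
  suff [m mP] : exists m, forall n, (m <= n)%N -> `|rep x t| <= rep (V n) t.
    apply/cvgrPdist_lt => r r0; exists m => // n /= /mP h.
    by rewrite trt clip_id// !subrr normr0.
  have [x0|xn0] := eqVneq (rep x t) 0.
    by exists 0%N => n _; rewrite x0 normr0; have [] := Vt n.
  have [i ai] : exists i, rep (a i) t != 0.
    have nx : 0 < `|rep x t| by rewrite normr_gt0.
    have /cvgrPdist_lt/(_ _ nx)[n _ /(_ n (leqnn n)) h] := kt.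
    exists (k n); apply/eqP => a0; move: h; rewrite a0 subr0 ltxx//.
  have ai0 : 0 < `|rep (a i) t| by rewrite normr_gt0.
  exists (maxn i.+1 (Num.truncn (`|rep x t| / `|rep (a i) t|)).+1) => n.
  rewrite geq_max => /andP[ni nt]; have [_ /(_ i ni)] := Vt n; apply: le_trans.
  rewrite -ler_pdivrMr//; apply: (le_trans (ltW (truncnS_gt _))).
  by rewrite ler_nat.
have [n /(_ n (leqnn n)) xn] : exists n, forall m, (n <= m)%N ->
    `|tr (N, x) - tr (N, a (k m))| < eps / 2.
  apply: (@order_continuous_dominated _ _ _ _ X
    (fun m => tr (N, x) - tr (N, a (k m))) (2 *: V N)) => //.
    move=> n; move: (repB (tr (N, x)) (tr (N, a (k n)))) (trP (N, x))
      (trP (N, a (k n))) (V0 N) (repZ 2 (V N)).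
    apply: filterS5 => t -> -> -> h -> /=.
    rewrite (@ger0_norm _ (2 * _)) ?mulr_ge0//; apply: le_trans (ler_normB _ _) _.
    by have := clip_norm_le (rep x t) h; have := clip_norm_le (rep (a (k n)) t) h; lra.
  have trB : \forall t \ae mu, forall n, rep (tr (N, x) - tr (N, a (k n))) t =
      clip (rep (V N) t) (rep x t) - clip (rep (V N) t) (rep (a (k n)) t).
    apply: ae_foralln => n; move: (repB (tr (N, x)) (tr (N, a (k n)))) (trP (N, x))
      (trP (N, a (k n))).
    by apply: filterS3 => t -> -> ->.
  move: trB (V0 N) kx; apply: filterS3 => t trt h kt.
  apply/cvgrPdist_lt => r r0.
  have /cvgrPdist_lt/(_ r r0)[m _ mP] := kt.
  exists m => // n /= /mP; rewrite sub0r normrN trt; apply: le_lt_trans.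
  exact: clip_dist.
exists (pickle (N, k n)); rewrite pickleK/=.
have := ler_distD (tr (N, x)) x (tr (N, a (k n))); lra.
Qed.

End lattice_separability.

(** * The weighted L^1-norm on the lattice *)

Section weighted_seminorm.
Context d (T : measurableType d) (R : realType) (mu : {measure set T -> \bar R}).
Variable X : banachFunctionLattice mu.
Hypotheses (fat : fatou_property X) (oc : order_continuous X).
Variables (W : T -> R) (C : R).
Hypotheses (mW : measurable_fun setT W) (W0 : forall t, 0 < W t) (Wi : integ mu W)
  (WC : forall x : X, integ mu (fun t => `|rep x t| * W t) /\
     \int[mu]_t (`|rep x t| * W t) <= C * `|x|)
  (WUI : forall M del : R, 0 < del -> exists2 N, 0 <= N & forall x : X, `|x| <= M ->
    integ mu (fun t => excess N (rep x t) * W t) /\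
    \int[mu]_t (excess N (rep x t) * W t) <= del).

Definition wnorm (x : X) := \int[mu]_t (`|rep x t| * W t).

Let mrep (x : X) : measurable_fun setT (rep x).
Proof. exact: measurable_rep. Qed.

Let wi x : integ mu (fun t => `|rep x t| * W t) := (WC x).1.

Lemma wnorm_seminorm : seminorm wnorm.
Proof.
split=> [x y|s x]; rewrite /wnorm.
  rewrite -RintegralD//; [|exact: wi|exact: wi].
  apply: Rint_le_ae; [exact: wi|by apply: integD; exact: wi|].
  apply: filterS (repD x y) => t ->.
  by rewrite -mulrDl ler_pM2r// ler_normD.
rewrite -RintegralZl//; last exact: wi.
apply: ae_eq_Rint; [exact: integ_measurable (wi _)|exact: integ_measurable (integZ _ (wi _))|].
by apply: filterS (repZ s x) => t ->; rewrite normrM mulrA.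
Qed.

Let fast_diff (u v : nat -> X) : (forall n, wnorm (u n - v n) <= 8^-1 ^+ n) ->
  \forall t \ae mu, exists K, forall n, `|rep (u n) t - rep (v n) t| <= K * 4^-1 ^+ n.
Proof.
move=> uv; have h : \forall t \ae mu, forall n,
    rep (u n - v n) t = rep (u n) t - rep (v n) t.
  by apply: ae_foralln => n; exact: repB.
have uv1 n : wnorm (u n - v n) <= 1 * 8^-1 ^+ n by rewrite mul1r.
have := @fast_ae _ _ _ mu (fun n t => rep (u n - v n) t) W 1 W0 (fun n => wi _) uv1.
by apply: filterS2 h => t h [K KP]; exists K => n; rewrite -h.
Qed.

Let fast_cvg (x : X) (v : nat -> X) : (forall n, wnorm (x - v n) <= 8^-1 ^+ n) ->
  \forall t \ae mu, rep (v n) t @[n --> \oo] --> rep x t.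
Proof.
move=> /(fast_diff (u := fun=> x)); apply: filterS => t [K KP].
have K0 : 0 <= K.
  by have := KP 0%N; rewrite expr0 mulr1; apply: le_trans.
apply/cvgrPdist_lt => e e0.
have [|n nP] := @half_expr_lt R (e / (K + 1)); first by rewrite divr_gt0// ltr_wpDl.
exists n => // m /= nm; apply: le_lt_trans (KP m) _.
rewrite ltr_pdivlMr ?ltr_wpDl// in nP; apply: le_lt_trans nP.
have h1 : (4^-1 : R) ^+ m <= 2^-1 ^+ n.
  apply: (@le_trans _ _ ((2^-1 : R) ^+ m)); first by apply: lerXn2r; rewrite ?nnegrE; lra.
  by apply: ler_wiXn2l => //; lra.
have h2 : 0 <= (2^-1 : R) ^+ n by exact: exprn_ge0.
have h3 := ler_wpM2l K0 h1.
by move: h2 h3; move: (2^-1 ^+ n) (4^-1 ^+ m) => p1 p2; lra.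
Qed.

Let qclosure_seq (A : set X) (x : X) : qclosure wnorm A x ->
  exists v : nat -> X, (forall n, A (v n)) /\ forall n, wnorm (x - v n) <= 8^-1 ^+ n.
Proof.
move=> Ax.
have /choice[v vP] n : exists y, A y /\ wnorm (x - y) <= 8^-1 ^+ n.
  have [|y Ay xy] := Ax (8^-1 ^+ n); first by rewrite exprn_gt0.
  by exists y; split => //; exact: ltW.
by exists v; split => n; have [] := vP n.
Qed.

Lemma wnorm_balls : balls_qclosed wnorm.
Proof.
move=> x M /qclosure_seq[v [vM /fast_cvg xv]].
have [z zx zM] := fatou_ae_limit fat (mrep x) vM xv.
by rewrite -(rep_inj zx).
Qed.

(** Fast sequences converge almost everywhere, the Fatou property places the limit in [X], and
    Fatou's lemma for integrals yields convergence for [wnorm]. *)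
Lemma wnorm_complete : bounded_qcomplete wnorm.
Proof.
move=> u M uM ud; have sq := wnorm_seminorm.
have [f mf fP] := measurable_limit (fun n => mrep (u n)).
have uf : \forall t \ae mu, rep (u n) t @[n --> \oo] --> f t.
  apply: filterS (fast_diff (u := fun n => u n.+1) (v := u) ud) => t [K KP].
  by have [l [ul _]] := fast_cauchy_limit KP; rewrite (fP _ _ ul).
have [x xf xM] := fatou_ae_limit fat mf uM uf.
exists x.
have q0 n : 0 <= (8^-1 : R) ^+ n by apply: exprn_ge0; lra.
have dist m n : wnorm (u (n + m)%N - u m) <= 2 * 8^-1 ^+ m.
  suff : wnorm (u (n + m)%N - u m) <= 2 * 8^-1 ^+ m - 2 * 8^-1 ^+ (n + m).
    by move=> h; apply: le_trans h _; rewrite gerBl mulr_ge0.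
  elim: n => [|n IH]; first by rewrite add0n !subrr seminorm0.
  rewrite addSn exprS.
  have := seminorm_triangle sq (u (n + m).+1) (u (n + m)%N) (u m).
  have := ud (n + m)%N; have := q0 (n + m)%N; move: IH.
  by move: (8^-1 ^+ m) (8^-1 ^+ (n + m)) => p1 p2; lra.
have lim m : wnorm (x - u m) <= 2 * 8^-1 ^+ m.
  have [|||||_ h] := @fatou_bound _ _ _ mu (fun n t => `|rep (u (n + m)%N - u m) t| * W t)
     (fun t => `|rep (x - u m) t| * W t) (2 * 8^-1 ^+ m) (fun n => wi _).
  - by move=> n t; rewrite mulr_ge0// ltW.
  - exact: integ_measurable (wi _).
  - by move=> t; rewrite mulr_ge0// ltW.
  - have uB : \forall t \ae mu, forall n,
        rep (u (n + m)%N - u m) t = rep (u (n + m)%N) t - rep (u m) t.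
      by apply: ae_foralln => n; exact: repB.
    move: uB (repB x (u m)) uf xf; apply: filterS4 => t uB -> ut ->.
    apply: cvgMr_tmp; apply: cvg_norm.
    under eq_fun do rewrite uB.
    by apply: cvgB; [rewrite -(cvg_shiftn m) in ut|exact: cvg_cst].
  - exact: dist.
  exact: h.
move=> e e0; have [|n nP] := @half_expr_lt R (e / 2); first by rewrite divr_gt0.
exists n => m nm; apply: le_lt_trans (lim m) _.
have h1 : (8^-1 : R) ^+ m <= 2^-1 ^+ n.
  apply: (@le_trans _ _ ((2^-1 : R) ^+ m)); first by apply: lerXn2r; rewrite ?nnegrE; lra.
  by apply: ler_wiXn2l => //; lra.
by move: nP h1; move: (2^-1 ^+ n) (8^-1 ^+ m) => p1 p2; lra.
Qed.

Let huber_integ N (x : X) : 0 <= N -> integ mu (fun t => huber N (rep x t) * W t).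
Proof.
move=> N0; apply: integ_le (integZ (2 * N) (wi x)).
  by apply: measurable_funM => //; exact: (measurableT_comp (measurable_huber _)).
move=> t; rewrite mulrA !normrM normr_id ler_wpM2r//.
by rewrite (ger0_norm N0) (@ger0_norm _ 2)//; exact: huber_norm_le.
Qed.

(** [Phi] integrates [huber N], which is quadratic up to the level [N]; uniform integrability keeps
    the mass above [N] small on the ball of radius [M]. *)
Lemma wnorm_uniformly_convex : bounded_quniformly_convex wnorm.
Proof.
move=> M r r0; have sq := wnorm_seminorm.
have [N N0 NP] := WUI M (divr_gt0 r0 (ltr0Sn R 7)).
pose IW := \int[mu]_t W t.
have IW0 : 0 <= IW by apply: Rintegral_ge0 => t _; exact: ltW.
(* The term [e * IW] takes at most [r / 4] of the distance and the two [excess] integrals at most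
   [r / 8] each; what remains must come from the convexity gap. *)
pose e := r / (4 * (IW + 1)).
have e0 : 0 < e by rewrite divr_gt0// mulr_gt0// ltr_wpDl.
have eIW : e * IW <= r / 4.
  rewrite /e invfM mulrA -[leLHS]mulrA -[leRHS]mulr1; apply: ler_wpM2l.
    by apply: divr_ge0; [exact: ltW|].
  by rewrite mulrC ler_pdivrMr ?ltr_wpDl// mul1r lerDl.
pose Phi (x : X) := \int[mu]_t (huber N (rep x t) * W t).
have hi x := huber_integ x N0.
exists Phi, (2 * N), (e * (r / 4)); split.
- by rewrite mulr_gt0// divr_gt0.
- move=> x y t t0 t1; rewrite /Phi -!RintegralZl//; [|exact: hi|exact: hi].
  rewrite -RintegralD//; [|exact: (integZ _ (hi _))|exact: (integZ _ (hi _))].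
  apply: Rint_le_ae; [exact: hi|by apply: integD; exact: (integZ _ (hi _))|].
  move: (repD (t *: x) ((1 - t) *: y)) (repZ t x) (repZ (1 - t) y).
  apply: filterS3 => s -> -> ->; rewrite !mulrA -mulrDl ler_pM2r//.
  exact: huber_convex.
- move=> x y; rewrite /Phi -RintegralB//; [|exact: hi|exact: hi].
  rewrite /wnorm -RintegralZl//; last exact: wi.
  have i1 := integD (hi x) (integZ (-1) (hi y)).
  have E : (fun t => huber N (rep x t) * W t - huber N (rep y t) * W t) =
     (fun t => huber N (rep x t) * W t + -1 * (huber N (rep y t) * W t)).
    by apply/funext => t; rewrite mulN1r.
  rewrite E; apply: Rint_le_ae => //; first exact: (integZ _ (wi _)).
  apply: filterS (repB x y) => t ->; rewrite mulN1r -mulrBl mulrA ler_pM2r//.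
  exact: huber_lipschitz.
move=> x y xM yM rxy; set m : X := 2^-1 *: x + _.
have [exi exI] := NP x xM; have [eyi eyI] := NP y yM.
pose G t := 2^-1 * (huber N (rep x t) * W t) +
  ((1 - 2^-1) * (huber N (rep y t) * W t) + -1 * (huber N (rep m t) * W t)).
have Gi : integ mu G.
  by apply: integD; [exact: (integZ _ (hi _))|apply: integD; exact: (integZ _ (hi _))].
have GE : \int[mu]_t G t = 2^-1 * Phi x + ((1 - 2^-1) * Phi y + -1 * Phi m).
  rewrite /G RintegralD//; [|exact: (integZ _ (hi _))|by apply: integD; exact: (integZ _ (hi _))].
  rewrite RintegralD//; [|exact: (integZ _ (hi _))|exact: (integZ _ (hi _))].
  by rewrite !(RintegralZl _ measurableT (hi _)).
have i1 := integZ e Wi; have i2 := integZ e^-1 Gi; have i3 := integD exi eyi.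
have le : wnorm (x - y) <= \int[mu]_t (e * W t + (e^-1 * G t +
    (excess N (rep x t) * W t + excess N (rep y t) * W t))).
  apply: Rint_le_ae; [exact: wi|exact: (integD i1 (integD i2 i3))|].
  move: (repB x y) (repD (2^-1 *: x) ((1 - 2^-1) *: y)) (repZ 2^-1 x) (repZ (1 - 2^-1) y).
  apply: filterS4 => t -> e1 e2 e3.
  have := huber_gap (rep x t) (rep y t) N0 e0; rewrite -e2 -e3 -e1 -/m => h.
  rewrite [leRHS](_ : _ = (e + e^-1 * (2^-1 * huber N (rep x t) +
     (1 - 2^-1) * huber N (rep y t) - huber N (rep m t)) +
     (excess N (rep x t) + excess N (rep y t))) * W t); last by rewrite /G; ring.
  by rewrite ler_pM2r.
have i23 := integD i2 i3.
rewrite RintegralD// RintegralD// RintegralD// RintegralZl// RintegralZl// -/IW GE in le.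
have gap : r / 4 <= e^-1 * (2^-1 * Phi x + ((1 - 2^-1) * Phi y + -1 * Phi m)) by lra.
rewrite [leRHS]mulrC ler_pdivlMr// in gap; lra.
Qed.

Theorem weighted_rnp : radon_nikodym_property X.
Proof.
apply: (@abstract_rnp _ _ _ wnorm_seminorm C (fun x => (WC x).2) wnorm_balls
  wnorm_complete wnorm_uniformly_convex) => a.
have [e eP] := ae_limits_separable oc a; exists e => x /qclosure_seq[v [va vx]].
have /choice[k kP] n : exists k, a k = v n by have [k _ <-] := va n; exists k.
apply: (eP x k); apply: filterS (fast_cvg vx) => t.
by have -> : (fun n => rep (v n) t) = (fun n => rep (a (k n)) t)
  by apply/funext => n; rewrite kP.
Qed.

End weighted_seminorm.

Theorem order_continuous_rnp d (T : measurableType d) (R : realType)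
    (mu : {sigma_finite_measure set T -> \bar R}) (X : banachFunctionLattice mu) :
  fatou_property X ->
  order_continuous_part (kothe_norm X) = simple_closure (kothe_norm X) ->
  order_continuous X -> radon_nikodym_property X.
Proof.
move=> fat dual oc.
have [h [mh h0 h1 hi]] := sigma_finite_weight mu.
have [w [mw w0 w1 wi [C wC]]] := exists_dual_weight fat mh h0 h1 hi.
have ww t : w t ^+ 2 <= w t by rewrite expr2 ler_piMl// ltW.
have mw2 : measurable_fun setT (fun t => w t ^+ 2) by exact: measurable_funX.
have w20 t : 0 < w t ^+ 2 by rewrite exprn_gt0.
have w2x (x : X) : integ mu (fun t => `|rep x t| * w t ^+ 2).
  apply: integ_le (wC x).1.
    apply: measurable_funM => //; apply: measurableT_comp => //; exact: measurable_rep.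
  move=> t; rewrite !(ger0_norm (mulr_ge0 _ _)) ?(ltW (w0 t)) ?(ltW (w20 t))//.
  exact: ler_wpM2l.
apply: (@weighted_rnp _ _ _ mu X fat oc (fun t => w t ^+ 2) C) => //.
- apply: integ_le wi => // t; rewrite !gtr0_norm//.
- move=> x; split => //; apply: le_trans (wC x).2; apply: Rint_le => //.
    exact: (wC x).1.
  by move=> t; exact: ler_wpM2l.
- move=> M del del0.
  have [N N0 NP] := dual_uniform_integrability mw w0 w1 wi wC M del0 dual.
  exists N => // x xM; split; last exact: NP.
  exact: (integ_excess mw w0 w1 wC x N0).
Qed.

Theorem theorem3p1 (d : measure_display) (T : measurableType d) (R : realType)
    (mu : {sigma_finite_measure set T -> \bar R})
    (mu_complete : measure_is_complete mu)
    (X : banachFunctionLattice mu) :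
  (radon_nikodym_property X -> order_continuous X) /\
  (fatou_property X ->
   order_continuous_part (kothe_norm X) = simple_closure (kothe_norm X) ->
   order_continuous X -> radon_nikodym_property X).
Proof. by split; [exact: rnp_order_continuous|exact: order_continuous_rnp]. Qed.
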